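(* Let $\mathcal{M}$ be a finite-dimensional smooth manifold, let $X$ be a smooth vector field on $\mathcal{M}$ (an autonomous system $\dot x = X(x)$) with flow $\varphi$, and let $\mathcal{S}\subseteq\mathcal{M}$ be a compact submanifold that is asymptotically stable for $\varphi$. Let $\mathcal{D}_A$ be the domain of attraction of $\mathcal{S}$. Then $\mathcal{D}_A$ is homeomorphic to any tubular neighborhood $\mathcal{W}$ (viewed as an open subset of $\mathcal{M}$) of $\mathcal{S}$ in $\mathcal{M}$.
   Context: Manifolds and submanifolds are without boundary, second countable and paracompact (and Hausdorff); submanifolds are smooth embedded submanifolds. $\varphi^t(x)$ denotes the position at time $t$ of the trajectory of $X$ starting at $x$. A closed set $\mathcal{S}$ is invariant if $\varphi^t(\mathcal{S})=\mathcal{S}$ for all $t$. A trajectory $\varphi^t(x)$ converges to $\mathcal{S}$ if it exists for all $t\ge 0$ and its distance to $\mathcal{S}$ tends to $0$ as $t\to+\infty$ (for compact $\mathcal{S}$: for every neighborhood $V$ of $\mathcal{S}$, $\varphi^t(x)\in V$ for all sufficiently large $t$). A compact invariant set $\mathcal{S}$ is asymptotically stable if (i) it is attractive: there is an open neighborhood of $\mathcal{S}$ such that every trajectory starting in it converges to $\mathcal{S}$; and (ii) it is Lyapunov stable: for every neighborhood $V$ of $\mathcal{S}$ there is a neighborhood $U$ of $\mathcal{S}$ such that, for every $x\in U$, $\varphi^t(x)$ exists and lies in $V$ for all $t\ge0$. The domain of attraction of $\mathcal{S}$ is the set of all $x\in\mathcal{M}$ whose trajectory converges to $\mathcal{S}$.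 Tubular neighborhood: for a vector bundle $\mathcal{E}$ over $\mathcal{S}$, let $\bar 0_{\mathcal{S}}\subseteq\mathcal{E}$ be the image of the zero section and let $\iota_{\mathcal{S}}:\bar 0_{\mathcal{S}}\to\mathcal{S}\subseteq\mathcal{M}$, $0_x\mapsto x$, where $0_x$ is the zero vector of the fiber $\mathcal{E}_x$. A tubular neighborhood of $\mathcal{S}$ in $\mathcal{M}$ is an open smooth embedding $\tau:\mathcal{E}\to\mathcal{M}$ from some smooth vector bundle $\mathcal{E}$ over $\mathcal{S}$ with $\tau|_{\bar 0_{\mathcal{S}}}=\iota_{\mathcal{S}}$; the open set $\mathcal{W}=\tau(\mathcal{E})$ is also called a tubular neighborhood of $\mathcal{S}$. *)

(* Defs.v *)
From HB Require Import structures.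
From mathcomp Require Import all_boot all_order all_algebra.
From mathcomp Require Import all_classical all_reals all_analysis.

Set Implicit Arguments.
Unset Strict Implicit.
Unset Printing Implicit Defensive.

Import Order.TTheory GRing.Theory Num.Theory.
Import numFieldNormedType.Exports.

Local Open Scope classical_set_scope.
Local Open Scope ring_scope.

(* [U] is meant to be open: f is C^(k+1) on U iff it is differentiable at every
   point of U and all its directional derivatives are C^k on U. *)
Fixpoint Ck (R : realType) (m n k : nat) (U : set 'rV[R]_m)
    (f : 'rV[R]_m -> 'rV[R]_n) : Prop :=
  match k with
  | 0%N => forall x, U x -> {for x, continuous f}
  | k'.+1 => (forall x, U x -> differentiable f x) /\
             (forall v, Ck k' U (fun x => 'D_v f x))
  end.

Definition Cinfty (R : realType) (m n : nat) (U : set 'rV[R]_m)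
    (f : 'rV[R]_m -> 'rV[R]_n) : Prop :=
  forall k, Ck k U f.

(* A chart is a homeomorphism from [dom] onto an open subset of R^n.  Both it and
   its inverse are represented by total functions; the values of [fwd] outside
   [dom] and of [bwd] outside [img] are irrelevant.  This record is raw data, the
   axioms are in [is_chart]. *)
Record chart (R : realType) (n : nat) (T : topologicalType) := Chart {
  dom : set T;
  fwd : T -> 'rV[R]_n;
  bwd : 'rV[R]_n -> T }.

Definition img (R : realType) (n : nat) (T : topologicalType)
    (c : chart R n T) : set 'rV[R]_n := fwd c @` dom c.

Definition is_chart (R : realType) (n : nat) (T : topologicalType)
    (c : chart R n T) : Prop :=
  [/\ open (dom c), open (img c),
      (forall x, dom c x -> bwd c (fwd c x) = x),
      (forall x, dom c x -> {for x, continuous (fwd c)})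
    & (forall y, img c y -> {for y, continuous (bwd c)})].

Definition smooth_atlas (R : realType) (n : nat) (T : topologicalType)
    (A : set (chart R n T)) : Prop :=
  [/\ (forall c, A c -> is_chart c),
      (forall x, exists2 c, A c & dom c x)
    & (forall c c', A c -> A c' ->
         Cinfty (fwd c @` (dom c `&` dom c')) (fwd c' \o bwd c))].

Definition paracompact (T : topologicalType) : Prop :=
  forall C : set (set T),
    (forall U, C U -> open U) -> \bigcup_(U in C) U = setT ->
    exists D : set (set T),
      [/\ (forall V, D V -> open V),
          \bigcup_(V in D) V = setT,
          (forall V, D V -> exists2 U, C U & V `<=` U)
        & (forall x : T, exists2 N, nbhs x N &
             finite_set [set V | D V /\ V `&` N !=set0])].

(* The smooth structure is the one determined by the atlas [A], which need not be
   maximal. *)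
Definition smooth_manifold (R : realType) (n : nat) (T : topologicalType)
    (A : set (chart R n T)) : Prop :=
  [/\ hausdorff_space T, @second_countable T, paracompact T & smooth_atlas A].

Definition euclidean_atlas (R : realType) (n : nat) : set (chart R n 'rV[R]_n) :=
  [set Chart setT id id].

Definition prod_chart (R : realType) (m n : nat) (T T' : topologicalType)
    (c : chart R m T) (c' : chart R n T') : chart R (m + n) (T * T')%type :=
  Chart (dom c `*` dom c')
        (fun z => row_mx (fwd c z.1) (fwd c' z.2))
        (fun y => (bwd c (lsubmx y), bwd c' (rsubmx y))).

Definition prod_atlas (R : realType) (m n : nat) (T T' : topologicalType)
    (A : set (chart R m T)) (A' : set (chart R n T')) :
    set (chart R (m + n) (T * T')%type) :=
  [set c | exists c1 c2, [/\ A c1, A' c2 & c = prod_chart c1 c2]].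

Section Maps.
Context {R : realType} {m n : nat} {T T' : topologicalType}.
Variables (A : set (chart R m T)) (A' : set (chart R n T')).

(* [D] is meant to be open. *)
Definition smooth_on (D : set T) (f : T -> T') : Prop :=
  (forall x, D x -> {for x, continuous f}) /\
  (forall c c', A c -> A' c' ->
     Cinfty (fwd c @` (dom c `&` D `&` f @^-1` dom c'))
            (fwd c' \o f \o bwd c)).

Definition immersion (f : T -> T') : Prop :=
  forall x c c', A c -> A' c' -> dom c x -> dom c' (f x) ->
    injective ('d (fwd c' \o f \o bwd c) (fwd c x)).

Definition topological_embedding (f : T -> T') : Prop :=
  [/\ injective f, continuous f
    & (forall U, open U -> exists2 V, open V & U = f @^-1` V)].

Definition smooth_embedding (f : T -> T') : Prop :=
  [/\ smooth_on setT f, immersion f & topological_embedding f].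

End Maps.

Definition diffeomorphism_on (R : realType) (m n : nat) (T T' : topologicalType)
    (A : set (chart R m T)) (A' : set (chart R n T')) (D : set T) (D' : set T')
    (f : T -> T') (g : T' -> T) : Prop :=
  [/\ open D /\ open D', smooth_on A A' D f, smooth_on A' A D' g,
      (forall x, D x -> D' (f x) /\ g (f x) = x)
    & (forall y, D' y -> D (g y) /\ f (g y) = y)].

(* [set_type S] carries the subspace topology. *)
Definition embedded_submanifold (R : realType) (n k : nat) (M : topologicalType)
    (AM : set (chart R n M)) (S : set M) (AS : set (chart R k (set_type S))) :
    Prop :=
  smooth_manifold AS /\ smooth_embedding AS AM (set_val : set_type S -> M).

Record vector_bundle (R : realType) (k : nat) (B : topologicalType)
    (AB : set (chart R k B)) (r : nat) := VectorBundle {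
  total_space : topologicalType;
  total_atlas : set (chart R (k + r) total_space);
  total_manifold : smooth_manifold total_atlas;
  bundle_proj : total_space -> B;
  proj_smooth : smooth_on total_atlas AB setT bundle_proj;
  fiber : B -> lmodType R;
  fiber_incl : forall x, fiber x -> total_space;
  (* the vector space structure of [fiber x] is thus one on the subset
     [bundle_proj @^-1` [set x]] of the total space *)
  fiber_bij : forall x, set_bij setT (bundle_proj @^-1` [set x]) (@fiber_incl x);
  local_trivialization : forall x0 : B, exists U : set B,
    [/\ open U, U x0
      & exists (Phi : total_space -> B * 'rV[R]_r)
               (Psi : B * 'rV[R]_r -> total_space),
          [/\ diffeomorphism_on total_atlas
                (prod_atlas AB (@euclidean_atlas R r))
                (bundle_proj @^-1` U) (U `*` setT) Phi Psi,
              (forall e, U (bundle_proj e) -> (Phi e).1 = bundle_proj e)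
            & (forall x, U x -> forall (a : R) (u v : fiber x),
                 (Phi (fiber_incl (a *: u + v))).2 =
                 a *: (Phi (fiber_incl u)).2 + (Phi (fiber_incl v)).2)]] }.

Definition zero_section (R : realType) (k : nat) (B : topologicalType)
    (AB : set (chart R k B)) (r : nat) (E : vector_bundle AB r) (x : B) :
    total_space E :=
  fiber_incl (0 : fiber E x).

Definition tubular_neighborhood (R : realType) (n k r : nat)
    (M : topologicalType) (AM : set (chart R n M)) (S : set M)
    (AS : set (chart R k (set_type S))) (E : vector_bundle AS r)
    (tau : total_space E -> M) : Prop :=
  [/\ smooth_embedding (@total_atlas _ _ _ _ _ E) AM tau,
      (forall O, open O -> open (tau @` O))
    & (forall x : set_type S, tau (zero_section E x) = set_val x)].

(* A vector field is given by its components in every chart, [X c x] being the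
   coordinates of X(x) in the chart [c]; they transform by the differentials of
   the transition maps. *)
Definition smooth_vector_field (R : realType) (n : nat) (M : topologicalType)
    (A : set (chart R n M)) (X : chart R n M -> M -> 'rV[R]_n) : Prop :=
  (forall c c' x, A c -> A c' -> dom c x -> dom c' x ->
     X c' x = 'd (fwd c' \o bwd c) (fwd c x) (X c x)) /\
  (forall c, A c -> Cinfty (img c) (X c \o bwd c)).

Section Dynamics.
Context {R : realType} {n : nat} {M : topologicalType}.
Variables (A : set (chart R n M)) (X : chart R n M -> M -> 'rV[R]_n).

Definition integral_curve (a b : R) (gamma : R -> M) : Prop :=
  forall t, a < t < b ->
    {for t, continuous gamma} /\
    (forall c, A c -> dom c (gamma t) ->
       is_derive t 1 (fwd c \o gamma) (X c (gamma t))).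

(* The graph of the (possibly incomplete) flow: [flow t x y] says that phi^t(x)
   exists and equals y. *)
Definition flow (t : R) (x y : M) : Prop :=
  exists (a b : R) (gamma : R -> M),
    [/\ a < 0 < b, a < t < b, integral_curve a b gamma,
        gamma 0 = x & gamma t = y].

(* phi^t(x) exists and lies in V *)
Definition flows_into (t : R) (x : M) (V : set M) : Prop :=
  exists2 y, V y & flow t x y.

Definition flow_invariant (S : set M) : Prop :=
  forall t, (forall x, S x -> flows_into t x setT) /\
            [set y | exists2 x, S x & flow t x y] = S.

(* For compact S, "the distance to S tends to 0" is expressed by neighborhoods of
   S, so that no metric on M is involved. *)
Definition converges_to (S : set M) (x : M) : Prop :=
  (forall t, 0 <= t -> flows_into t x setT) /\
  (forall V, set_nbhs S V -> \forall t \near +oo, flows_into t x V).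

Definition attractive (S : set M) : Prop :=
  exists U, [/\ open U, S `<=` U & U `<=` converges_to S].

Definition Lyapunov_stable (S : set M) : Prop :=
  forall V, set_nbhs S V -> exists2 U, set_nbhs S U &
    forall x t, U x -> 0 <= t -> flows_into t x V.

Definition asymptotically_stable (S : set M) : Prop :=
  [/\ compact S, flow_invariant S, attractive S & Lyapunov_stable S].

Definition domain_of_attraction (S : set M) : set M :=
  [set x | converges_to S x].

End Dynamics.

Definition homeomorphic (T T' : topologicalType) : Prop :=
  exists (f : T -> T') (g : T' -> T),
    [/\ continuous f, continuous g, cancel f g & cancel g f].

(* Main.v *)
Require Import Defs.
From HB Require Import structures.
From mathcomp Require Import all_boot all_order all_algebra.
From mathcomp Require Import all_classical all_reals all_analysis.
From mathcomp Require Import ring lra.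

(* Brown's monotone union argument, with the flow supplying the homeomorphisms.
   Write [x <= y] when [y] lies on the forward trajectory of [x].  In a chart, let
   each point flow for a time given by a bump function whose slope along the flow
   is at most 1/2: this is a homeomorphism of M that moves points forward,
   preserves [<=] and is the identity off a small closed set.  Because of this
   monotonicity, composing such maps never undoes earlier progress, so for every
   compact K in the basin D and every neighborhood V of S a finite composition of
   them carries K into V, preserves D, and is the identity near S.
   On the bundle E, fix a continuous fiberwise norm with compact balls.  Shrinking
   the tubular map gives an open embedding h_0 of E into D.  Given h_n, let s be a
   radial homeomorphism of E that squeezes the ball of radius n into a tiny one and
   is the identity off the ball of radius n+1, and let g compress a large compact set
   into the image of the open ball of radius n+1.  Conjugating the inverse of g by s
   gives h_{n+1}, which agrees with h_n on the ball of radius n and whose image of the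
   ball of radius n+1 contains a prescribed compact set.  The limit of the h_n is a
   homeomorphism from E onto D. *)

Set Implicit Arguments.
Unset Strict Implicit.
Unset Printing Implicit Defensive.

Import Order.TTheory GRing.Theory Num.Theory.
Import numFieldNormedType.Exports.

Local Open Scope classical_set_scope.
Local Open Scope ring_scope.

(** * Ordinary differential equations in R^n *)

Section Clamp.
Context {R : realType}.
Implicit Types e s t : R.

(** For [0 <= e], the nearest-point retraction of the line onto the interval from [- e] to [e]. It
    replaces data given for bounded times or coordinates by globally Lipschitz data. *)
Definition clamp e t := Num.max (- e) (Num.min e t).

Lemma clamp_norm e t : 0 <= e -> `|clamp e t| <= e.
Proof.
by move=> e0; rewrite ler_norml le_max lexx/= ge_max ge_min lexx/= andbT; lra.
Qed.

Lemma clamp_id e t : `|t| <= e -> clamp e t = t.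
Proof. by rewrite ler_norml => /andP[? ?]; rewrite /clamp min_r// max_r. Qed.

Lemma clamp_lipschitz e s t : 0 <= e -> `|clamp e s - clamp e t| <= `|s - t|.
Proof.
move=> e0; wlog st : s t / s <= t.
  move=> W; have [/W//|/ltW/W] := leP s t.
  by rewrite distrC [X in _ <= X]distrC.
rewrite distrC (distrC s) (ger0_norm (_ : 0 <= t - s)) ?subr_ge0// ler_norml.
(* The position of a point relative to the interval; for [s <= t] the nine resulting cases are
   linear. *)
have H u : [\/ u <= - e /\ clamp e u = - e, e <= u /\ clamp e u = e |
    [/\ - e <= u, u <= e & clamp e u = u]].
  have [ue|ue] := leP u (- e); last have [eu|eu] := leP e u.
  - by constructor 1; split=> //; rewrite /clamp max_l// ge_min ue orbT.
  - by constructor 2; split=> //; rewrite /clamp min_l// max_r//; lra.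
  - by constructor 3; split; rewrite ?ltW// clamp_id// ler_norml; lra.
by case: (H s) => [[? ->]|[? ->]|[? ? ->]]; case: (H t) => [[? ->]|[? ->]|[? ? ->]]; lra.
Qed.

End Clamp.

(** * Mean value and Gronwall estimates in R^n *)

Section VectorCalculus.
Context {R : realType} {n : nat}.
Implicit Types (v w : 'rV[R]_n).

Lemma rV_coord_le v j : `|v ord0 j| <= `|v|.
Proof.
rewrite [leRHS]/Num.Def.normr /= mx_normrE.
exact: (le_bigmax _ (fun ij : 'I_1 * 'I_n => `|v ij.1 ij.2|) (ord0, j)).
Qed.

Lemma rV_norm_le v (C : R) : 0 <= C -> (forall j, `|v ord0 j| <= C) -> `|v| <= C.
Proof.
move=> C0 vC; rewrite [leLHS]/Num.Def.normr /= mx_normrE.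
by apply: bigmax_le => // -[i j] _; rewrite (ord1 i); exact: vC.
Qed.

Lemma is_derive_coord (f : R -> 'rV[R]_n) (t : R) (d : 'rV[R]_n) j :
  is_derive t 1 f d -> is_derive t 1 (fun s => f s ord0 j) (d ord0 j).
Proof.
move=> [df <-]; rewrite derive_mx//; apply: DeriveDef.
  by have /derivable_mxP := df; exact.
by rewrite mxE.
Qed.

Lemma is_derive_rV (f : R -> 'rV[R]_n) (t : R) (d : 'rV[R]_n) :
  (forall j, is_derive t 1 (fun s => f s ord0 j) (d ord0 j)) -> is_derive t 1 f d.
Proof.
move=> df; have fd : derivable f t 1.
  by apply/derivable_mxP => i j; rewrite (ord1 i); case: (df j).
apply: DeriveDef => //; rewrite derive_mx//; apply/rowP => j; rewrite mxE.
by case: (df j).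
Qed.

Lemma is_derive_continuous (V : normedModType R) (f : R -> V) (t : R) (d : V) :
  is_derive t 1 f d -> {for t, continuous f}.
Proof. by case=> df _; apply: differentiable_continuous; apply/derivable1_diffP. Qed.

Lemma is_derive_translate (V : normedModType R) (f : R -> V) (t s : R) (d : V) :
  is_derive (t + s) 1 f d -> is_derive t 1 (fun u => f (u + s)) d.
Proof.
move=> [df <-]; have E : (fun h : R => h^-1 *: (f (h *: 1 + t + s) - f (t + s)))
    = (fun h => h^-1 *: (f (h *: 1 + (t + s)) - f (t + s))).
  by apply/funext => h; rewrite addrA.
by apply: DeriveDef; rewrite /derivable /derive /= E.
Qed.

Lemma is_derive_comp (V W : normedModType R) (g : V -> W) (f : R -> V) (t : R) (d : V) :
  is_derive t 1 f d -> differentiable g (f t) ->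
  is_derive t 1 (g \o f) ('d g (f t) d).
Proof.
move=> [df <-] dg; have df' : differentiable f t by apply/derivable1_diffP.
apply: DeriveDef; first by apply/derivable1_diffP; exact: differentiable_comp.
rewrite deriveE; last exact: differentiable_comp.
by rewrite diff_comp//= (@deriveE _ _ _ f).
Qed.

(** The mean value theorem is applied to each coordinate; since the norm is the maximum norm, no
    constant is lost. *)
Lemma derive_bound (w dw : R -> 'rV[R]_n) a b C : a <= b -> 0 <= C ->
  (forall t : R, a <= t <= b -> is_derive t 1 w (dw t)) ->
  (forall t, a <= t <= b -> `|dw t| <= C) ->
  `|w b - w a| <= C * (b - a).
Proof.
move=> ab C0 wdw dwC; apply: rV_norm_le => [|j]; first by rewrite mulr_ge0// subr_ge0.
have [||c cab wE] := @MVT_segment R (fun t => w t ord0 j) (fun t => dw t ord0 j) a b ab.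
- move=> x; rewrite in_itv/= => /andP[/ltW ax /ltW xb].
  by apply: is_derive_coord; apply: wdw; rewrite ax.
- apply: continuous_in_subspaceT => x; rewrite inE/= in_itv/= => xab.
  by apply: is_derive_continuous; exact: is_derive_coord (wdw _ xab).
rewrite !mxE wE normrM (ger0_norm (_ : 0 <= b - a)) ?subr_ge0//.
rewrite ler_wpM2r ?subr_ge0// (le_trans (rV_coord_le _ _))//; apply: dwC.
by move: cab; rewrite in_itv.
Qed.

Lemma derive_bound_abs (w dw : R -> 'rV[R]_n) (A : set R) s t C : 0 <= C ->
  is_interval A -> A s -> A t ->
  (forall u : R, A u -> is_derive u 1 w (dw u)) ->
  (forall u, A u -> `|dw u| <= C) ->
  `|w t - w s| <= C * `|t - s|.
Proof.
move=> C0 iA As At wdw dwC; wlog st : s t As At / s <= t.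
  move=> W; have [/W|/ltW/W] := leP s t; first exact.
  by rewrite distrC (distrC s) => ->.
rewrite (ger0_norm (_ : 0 <= t - s)) ?subr_ge0//.
have iu u : s <= u <= t -> A u by apply: iA.
by apply: (@derive_bound w dw) => // u /iu; [exact: wdw|exact: dwC].
Qed.

(* A linear differential inequality on an interval so short that its length times
   [L] is at most 1/2 bounds a function by twice an initial value: no exponential
   is needed. *)
Lemma short_gronwall (w dw : R -> 'rV[R]_n) (A : set R) s t L : 0 <= L ->
  is_interval A -> A s -> A t -> `|t - s| * L <= 2^-1 ->
  (forall u : R, A u -> is_derive u 1 w (dw u)) ->
  (forall u, A u -> `|dw u| <= L * `|w u|) ->
  `|w t| <= 2 * `|w s|.
Proof.
move=> L0 iA As At stL wdw dwL.
pose a := Num.min s t; pose b := Num.max s t.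
have ab : a <= b by rewrite /a /b; case: (leP s t) => // /ltW.
have ba : b - a = `|t - s|.
  rewrite /a /b; case: (leP s t) => st; first by rewrite ger0_norm ?subr_ge0.
  by rewrite distrC gtr0_norm ?subr_gt0.
have abA u : a <= u <= b -> A u.
  by rewrite /a /b; case: (leP s t) => _; exact: iA.
have sI : a <= s <= b by rewrite /a /b; case: (leP s t) => [->|/ltW->]; rewrite lexx.
have tI : a <= t <= b by rewrite /a /b; case: (leP s t) => [->|/ltW->]; rewrite lexx.
(* Take [t1] maximizing the norm of [w] between [s] and [t]. From [s] to [t1] the slope is at most
   [L] times that maximum, so [w t1] differs from [w s] by at most half the maximum. This bounds the
   maximum, hence the norm at [t]. *)
have [||t1 + t1max] := @EVT_max R (fun t => `|w t|) a b.
- by [].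
- apply: continuous_in_subspaceT => x; rewrite inE/= in_itv/= => /abA xI.
  apply: continuous_comp; last exact: norm_continuous.
  exact: is_derive_continuous (wdw _ xI).
rewrite in_itv/= => t1I.
have W : `|w t1 - w s| <= (L * `|w t1|) * `|t1 - s|.
  apply: (derive_bound_abs (A := [set u | a <= u <= b])) => //=.
  - by rewrite mulr_ge0.
  - move=> x y /= /andP[ax _] /andP[_ yb] z /andP[xz zy].
    by rewrite (le_trans ax xz) (le_trans zy yb).
  - by move=> u /abA; exact: wdw.
  - move=> u uI; apply: (le_trans (dwL _ (abA _ uI))); rewrite ler_wpM2l//.
    by apply: t1max; rewrite in_itv.
have t1s : `|t1 - s| <= `|t - s|.
  rewrite -ba ler_distl; move: sI t1I => /andP[? ?] /andP[? ?]; lra.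
have W2 : `|w t1 - w s| <= 2^-1 * `|w t1|.
  apply: (le_trans W); rewrite mulrAC ler_wpM2r// (le_trans _ stL)// mulrC.
  by rewrite ler_wpM2r.
have W3 : `|w t1| <= 2 * `|w s|.
  have := ler_normD (w t1 - w s) (w s); rewrite subrK; lra.
by apply: le_trans W3; apply: t1max; rewrite in_itv.
Qed.

End VectorCalculus.

(** Near [p] each partial derivative is bounded by its norm at [p] plus one. Balls are convex, so
    the sum of these bounds controls the derivative along the segment from [y] to [x] and is a
    Lipschitz constant. *)
Lemma C1_locally_lipschitz (R : realType) (n m : nat)
    (f : 'rV[R]_n -> 'rV[R]_m) (U : set 'rV[R]_n) p :
  open U -> U p -> Ck 1 U f ->
  exists r L, [/\ 0 < r, 0 <= L, (forall x, `|x - p| <= r -> U x) &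
    forall x y, `|x - p| <= r -> `|y - p| <= r -> `|f x - f y| <= L * `|x - y|].
Proof.
move=> oU Up [df Df].
pose D j x := 'D_(delta_mx ord0 j) f x; pose C j := `|D j p| + 1.
have /nbhs_ballP[r /= r0 rP] : \forall x \near p, U x /\ forall j, `|D j x| <= C j.
  apply: filterI; first exact: open_nbhs_nbhs.
  apply: (@filter_forall _ 'I_n (fun j x => `|D j x| <= C j) (nbhs p) _) => j.
  have cD : D j @ p --> D j p by exact: (Df (delta_mx ord0 j) p Up).
  have lt : `|D j p| < C j by rewrite ltrDl.
  exact: (@cvgr_norm_le _ _ _ _ (nbhs_filter p) (D j) _ cD _ lt).
have rP' x : `|x - p| <= r / 2 -> U x /\ forall j, `|D j x| <= C j.
  move=> xp; apply: rP; rewrite -ball_normE /= distrC (le_lt_trans xp)//; lra.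
exists (r / 2), (\sum_j C j); split.
- by rewrite divr_gt0.
- by apply: sumr_ge0 => j _; rewrite addr_ge0.
- by move=> x /rP'[].
move=> x y xp yp; pose l (t : R) := t *: (x - y) + y.
have lr t : 0 <= t <= 1 -> `|l t - p| <= r / 2.
  move=> /andP[t0 t1].
  have -> : l t - p = t *: (x - p) + (1 - t) *: (y - p).
    rewrite /l !scalerBr !scalerBl !scale1r; apply/rowP => j; rewrite !mxE; ring.
  apply: (le_trans (ler_normD _ _)); rewrite !normrZ !ger0_norm ?subr_ge0//.
  have := ler_wpM2l t0 xp; have := ler_wpM2l (_ : 0 <= 1 - t) yp.
  rewrite subr_ge0 => /(_ t1); lra.
have dl (t : R) : is_derive t 1 l (x - y).
  apply: is_derive_rV => j; rewrite /l.
  apply: (@near_eq_is_derive _ _ _ (fun s : R => s * (x - y) ord0 j + y ord0 j)).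
    by near=> s; rewrite !mxE.
  by apply: is_derive_eq; rewrite /GRing.scale /=; ring.
have dw (t : R) : 0 <= t <= 1 -> is_derive t 1 (f \o l) ('d f (l t) (x - y)).
  by move=> /lr/rP'[Ul _]; apply: is_derive_comp (dl t) (df _ Ul).
have E : f x - f y = (f \o l) 1 - (f \o l) 0.
  by rewrite /l /= scale1r scale0r add0r subrK.
rewrite E -[leRHS]mulr1 -[X in _ * X](subr0 1).
apply: (derive_bound ler01 _ dw).
  by rewrite mulr_ge0// sumr_ge0// => j _; rewrite addr_ge0.
move=> t /lr/rP'[Ul DC].
rewrite (row_sum_delta (x - y)) linear_sum /= mulr_suml.
apply: (le_trans (ler_norm_sum _ _ _)); apply: ler_sum => j _.
rewrite linearZ /= normrZ -deriveE; last exact: df.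
rewrite [leRHS]mulrC; apply: ler_pM => //; [|exact: DC].
by rewrite -row_sum_delta; exact: rV_coord_le.
Unshelve. all: by end_near. Qed.

(** * Antiderivatives, geometric limits and Picard iteration *)

Section Antiderivative.
Context {R : realType} {n : nat}.

Lemma antiderivative (g : R -> R) (a b : R) : continuous g ->
  exists G : R -> R, forall x : R, a < x < b -> is_derive x 1 G (g x).
Proof.
move=> cg; exists (fun x => \int[@lebesgue_measure R]_(t in `[a, x]) g t)%R.
move=> x /andP[ax xb].
have [|dG Gx] := @continuous_FTC1_closed R g a x b xb _ ax (cg x).
  apply: continuous_compact_integrable; first exact: segment_compact.
  exact: continuous_subspaceT.
by apply: DeriveDef; [exact: dG|rewrite -derive1E; exact: Gx].
Qed.

Lemma antiderivative_rV (g : R -> 'rV[R]_n) (e : R) : continuous g ->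
  exists G : R -> 'rV[R]_n,
    G 0 = 0 /\ forall x : R, `|x| < e -> is_derive x 1 G (g x).
Proof.
move=> cg.
have /choice[G GE] : forall j : 'I_n, exists G : R -> R, forall x : R,
    - e < x < e -> is_derive x 1 G (g x ord0 j).
  move=> j; apply: (@antiderivative (fun x => g x ord0 j) (- e) e) => x.
  apply: (@continuous_comp _ _ _ g (fun v : 'rV[R]_n => v ord0 j)); first exact: cg.
  exact: coord_continuous.
exists (fun t => \row_j (G j t - G j 0)); split.
  by apply/rowP => j; rewrite !mxE subrr.
move=> x; rewrite ltr_norml => xe; apply: is_derive_rV => j.
apply: (@near_eq_is_derive _ _ _ (fun t => G j t - G j 0)).
  by near=> t; rewrite mxE.
by rewrite -[X in is_derive _ _ _ X]subr0; apply: is_deriveB; exact: GE.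
Unshelve. all: by end_near. Qed.

End Antiderivative.

(** Allows an inequality between limits to be checked up to a geometrically decaying error. *)
Lemma geometric_le (R : realType) (a b c : R) :
  (forall k, a <= b + c * 2^-1 ^+ k) -> a <= b.
Proof.
move=> abc; apply/ler_addgt0Pr => e e0.
have /cvgrPdist_lt/(_ e e0)[k _ /(_ k (leqnn k))] :
    c * 2^-1 ^+ k @[k --> \oo] --> (0 : R).
  have := @cvg_geometric R c 2^-1; apply.
  by rewrite ger0_norm ?invr_ge0// invf_lt1// ltr1n.
rewrite sub0r normrN => /= /(le_lt_trans (ler_norm _))/ltW ck.
by apply: (le_trans (abc k)); rewrite lerD2l.
Qed.

Lemma geometric_limit (R : realType) (n : nat) (u : nat -> 'rV[R]_n) (C : R) :
  (forall k, `|u k.+1 - u k| <= C * 2^-1 ^+ k) ->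
  exists l, forall k, `|l - u k| <= 2 * C * 2^-1 ^+ k.
Proof.
move=> uC.
have C0 : 0 <= C by have := uC 0%N; rewrite expr0 mulr1; exact: le_trans.
have h2 : (2^-1 : R) = 1 - 2^-1 by lra.
have ud k m : `|u (m + k)%N - u k| <= 2 * C * 2^-1 ^+ k.
  (* The sharper bound, with a difference of powers, is the one that passes through the induction on
     [m]. *)
  suff : `|u (m + k)%N - u k| <= 2 * C * (2^-1 ^+ k - 2^-1 ^+ (m + k)).
    move=> /le_trans; apply; rewrite ler_wpM2l ?mulr_ge0// gerBl exprn_ge0//.
  elim: m => [|m IH]; first by rewrite add0n !subrr normr0 mulr0.
  have := ler_normD (u (m.+1 + k)%N - u (m + k)%N) (u (m + k)%N - u k).
  rewrite addrA subrK => /le_trans; apply.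
  rewrite (le_trans (lerD (uC (m + k)%N) IH))// addSn exprS; lra.
have cu : cvgn u.
  apply/cauchy_cvgP; apply: cauchy_exP => e e0.
  have /cvgrPdist_lt/(_ e e0)[k _ /(_ k (leqnn k))] :
      (2 * C) * 2^-1 ^+ k @[k --> \oo] --> (0 : R).
    have := @cvg_geometric R (2 * C) 2^-1; apply.
    by rewrite ger0_norm ?invr_ge0// invf_lt1// ltr1n.
  rewrite sub0r normrN /= => /(le_lt_trans (ler_norm _)) ck.
  exists (u k); exists k => // m /= km; rewrite -ball_normE /= distrC.
  by rewrite (le_lt_trans _ ck)// -(subnK km).
exists (limn u) => k; rewrite distrC.
have /cvg_norm : (fun m => u k - u m) @ \oo --> u k - limn u.
  by apply: cvgB => //; exact: cvg_cst.
move=> cn; rewrite -(cvg_lim (@Rhausdorff R) cn); apply: limr_le.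
  exact: cvgP cn.
by exists k => // m /= km; rewrite distrC -{1}(subnK km).
Qed.

Lemma lipschitz_continuous (R : realType) (V W : normedModType R) (f : V -> W) (L : R) :
  0 <= L -> (forall x y, `|f x - f y| <= L * `|x - y|) -> continuous f.
Proof.
move=> L0 fL x; apply/cvgrPdist_lt => d d0; apply/nbhs_ballP.
have L1 : 0 < L + 1 by rewrite ltr_pwDr.
exists (d / (L + 1)) => /=; first by rewrite divr_gt0.
move=> z; rewrite -ball_normE/= ltr_pdivlMr// => xz.
apply: (le_lt_trans (fL _ _)); apply: le_lt_trans xz.
by rewrite mulrC ler_wpM2l// lerDl.
Qed.

Lemma cball_compact (R : realType) (n : nat) (p : 'rV[R]_n) (r : R) :
  compact [set y | `|y - p| <= r].
Proof.
apply: bounded_closed_compact.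
  exists (r + `|p|); split; first exact: num_real.
  move=> m mr y yr; rewrite /= -[y](subrK p) (le_trans (ler_normD _ _))//.
  by rewrite (le_trans _ (ltW mr))// lerD2r.
have cn : continuous (fun y : 'rV[R]_n => `|y - p|).
  apply: (@lipschitz_continuous _ _ _ _ 1) => // x y.
  by rewrite mul1r (le_trans (ler_dist_dist _ _))// opprB addrA subrK.
exact: (preimage_closed (fun x _ => cn x) (@closed_le R r)).
Qed.

(** Picard iteration with time clamped to the interval from [- e] to [e]: the iterates are then
    functions on the whole line with common Lipschitz constant [B], and [e * L <= 2^-1] halves the
    distance between successive iterates. *)
Lemma picard (R : realType) (n : nat) (e L B : R)
    (f : 'rV[R]_n -> 'rV[R]_n) (p : 'rV[R]_n) :
  0 < e -> 0 <= L -> e * L <= 2^-1 ->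
  (forall x y, `|f x - f y| <= L * `|x - y|) -> (forall x, `|f x| <= B) ->
  exists y : R -> 'rV[R]_n,
    y 0 = p /\ forall t : R, `|t| < e -> is_derive t 1 y (f (y t)).
Proof.
move=> e0 L0 eL fL fB.
have B0 : 0 <= B by apply: le_trans (fB 0).
(* Antiderivatives are taken on a larger interval: clamped times reach [e] itself, while
   differentiability is only available on an open interval. *)
pose h := 2 * e.
have cf : continuous f := lipschitz_continuous L0 fL.
(* An antiderivative operator as a total function; its value at a discontinuous [g] is arbitrary. *)
have /choice[P PP] : forall g : R -> 'rV[R]_n, exists G : R -> 'rV[R]_n,
    continuous g -> G 0 = 0 /\ forall x : R, `|x| < h -> is_derive x 1 G (g x).
  move=> g; have [cg|ncg] := pselect (continuous g); last by exists g.
  by have [G GP] := antiderivative_rV h cg; exists G.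
pose cl := clamp e.
have clI t : `|cl t| <= e by apply/clamp_norm/ltW.
have clh t : `|cl t| < h by rewrite (le_lt_trans (clI t))// /h; lra.
have cl_id t : `|t| <= e -> cl t = t by exact: clamp_id.
have cl_lip s t : `|cl s - cl t| <= `|s - t| by apply/clamp_lipschitz/ltW.
have cfc (y : R -> 'rV[R]_n) : continuous y -> continuous (f \o y).
  by move=> cy x; apply: (@continuous_comp _ _ _ y f); [exact: cy|exact: cf].
pose Phi (y : R -> 'rV[R]_n) t := p + P (f \o y) (cl t).
have iA : is_interval [set u : R | `|u| < h].
  move=> a b /=; rewrite !ltr_norml => /andP[? ?] /andP[? ?] c /andP[? ?].
  by rewrite ltr_norml; lra.
have iC : is_interval [set u : R | `|u| <= e].
  move=> a b /=; rewrite !ler_norml => /andP[? ?] /andP[? ?] c /andP[? ?].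
  by rewrite ler_norml; lra.
have PhiL y : continuous y -> forall s t, `|Phi y t - Phi y s| <= B * `|t - s|.
  move=> cy s t; have /PP[_ dP] := cfc _ cy.
  rewrite /Phi opprD addrACA subrr add0r.
  apply: (@le_trans _ _ (B * `|cl t - cl s|)); last by rewrite ler_wpM2l.
  apply: (derive_bound_abs (A := [set u : R | `|u| < h]) B0 iA (clh _) (clh _) dP).
  by move=> u uh; exact: fB.
have lipC (y : R -> 'rV[R]_n) :
    (forall s t, `|y t - y s| <= B * `|t - s|) -> continuous y.
  by move=> yL; apply: (lipschitz_continuous B0) => x z; exact: yL.
(* [Phi] contracts by the factor 1/2: the two antiderivatives agree at time 0, their derivatives
   differ by at most [L * C], and clamped time is at most [e]. *)
have PhiD y z C : 0 <= C -> continuous y -> continuous z ->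
    (forall t, `|y t - z t| <= C) -> forall t, `|Phi y t - Phi z t| <= 2^-1 * C.
  move=> C0 cy cz yz t.
  have [Py0 dPy] := PP _ (cfc _ cy); have [Pz0 dPz] := PP _ (cfc _ cz).
  rewrite /Phi opprD addrACA subrr add0r.
  have := @derive_bound_abs _ _ (fun u => P (f \o y) u - P (f \o z) u)
    (fun u => f (y u) - f (z u)) [set u : R | `|u| <= e] 0 (cl t) (L * C).
  rewrite Py0 Pz0 !subr0 => H.
  apply: (@le_trans _ _ (L * C * `|cl t|)).
    apply: H; [by rewrite mulr_ge0|exact: iC|by rewrite /= normr0 ltW|exact: clI| |].
    - move=> u /= ue; have uh : `|u| < h by rewrite (le_lt_trans ue)// /h; lra.
      by apply: is_deriveB; [exact: dPy|exact: dPz].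
    - by move=> u _; rewrite (le_trans (fL _ _))// ler_wpM2l.
  rewrite mulrAC ler_wpM2r// (le_trans _ eL)// mulrC ler_wpM2r//.
pose u k := iter k Phi (fun=> p).
have uL k s t : `|u k t - u k s| <= B * `|t - s|.
  elim: k s t => [|k IH] s t; first by rewrite /u/= subrr normr0 mulr_ge0.
  by apply: PhiL; exact: lipC.
have cu k : continuous (u k) by apply: lipC => s t; exact: uL.
have uD k t : `|u k.+1 t - u k t| <= B * e * 2^-1 ^+ k.
  elim: k t => [|k IH] t; last first.
    rewrite exprS mulrCA; apply: PhiD (cu k.+1) (cu k) IH t.
    by rewrite mulr_ge0 ?exprn_ge0 ?invr_ge0// mulr_ge0// ltW.
  rewrite expr0 mulr1 /u/=.
  have cc : continuous (f \o (fun=> p) : R -> _) by move=> x; exact: cvg_cst.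
  have [P0 dP0] := PP _ cc.
  rewrite /Phi addrAC subrr add0r.
  have h0 : `|0 : R| < h by rewrite normr0 mulr_gt0.
  have := derive_bound_abs (A := [set u : R | `|u| < h]) B0 iA h0 (clh t) dP0
    (fun u _ => fB _).
  by rewrite P0 !subr0 => /le_trans; apply; rewrite ler_wpM2l.
have /choice[y yu] : forall t, exists l, forall k, `|l - u k t| <= 2 * (B * e) * 2^-1 ^+ k.
  by move=> t; exact: (@geometric_limit R n (fun k => u k t) (B * e) (uD^~ t)).
(* The common Lipschitz constant passes to the limit, so [y] is continuous and [P] applies to
   [f \o y]. *)
have yL s t : `|y t - y s| <= B * `|t - s|.
  apply: (@geometric_le _ _ _ (2 * (2 * (B * e)))) => k.
  have -> : y t - y s = (y t - u k t) + (u k t - u k s) + (u k s - y s).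
    by rewrite !addrA !subrK.
  apply: (le_trans (ler_normD _ _)).
  apply: (le_trans (lerD (ler_normD _ _) (lexx _))).
  have := yu t k; have := yu s k; rewrite [in X in _ -> X]distrC.
  have := uL k s t; have := distrC (y s) (u k s); lra.
have cy : continuous y := lipC _ yL.
(* [y] is close to [u k.+1], which is [Phi (u k)], and by contraction this is close to [Phi y]. *)
have yfix t : y t = Phi y t.
  apply/eqP; rewrite -subr_eq0 -normr_le0.
  apply: (@geometric_le _ _ _ (2 * (2 * (B * e)))) => k.
  rewrite add0r -(subrK (u k.+1 t) (y t)) -addrA.
  apply: (le_trans (ler_normD _ _)).
  have := yu t k.+1; rewrite exprS.
  have /(_ t) : forall t, `|Phi (u k) t - Phi y t| <= 2^-1 * (2 * (B * e) * 2^-1 ^+ k).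
    apply: PhiD (cu k) cy _; last by move=> s; rewrite distrC.
    by rewrite !mulr_ge0 ?exprn_ge0 ?invr_ge0// ltW.
  have : 0 <= B * e * 2^-1 ^+ k.
    by rewrite mulr_ge0 ?exprn_ge0 ?invr_ge0// mulr_ge0// ltW.
  rewrite /u/=; lra.
have [P0 dP] := PP _ (cfc _ cy).
exists y; split; first by rewrite yfix /Phi cl_id ?normr0 ?ltW// P0 addr0.
move=> t te; apply: (@near_eq_is_derive _ _ _ (fun s => p + P (f \o y) s)).
  have : \forall s \near t, `|s| < e.
    exact: (cvgr_lt `|t| (@norm_continuous _ _ t)).
  by apply: filterS => s /ltW se; rewrite [RHS]yfix /Phi cl_id.
have th : `|t| < h by rewrite (lt_le_trans te)// /h; lra.
rewrite -[f (y t)]add0r.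
exact: (@is_deriveD _ _ _ (cst p) (P (f \o y)) t 1 0 _ (is_derive_cst p t 1) (dP t th)).
Qed.

(** * The short-time flow of a bounded Lipschitz field *)

Section LipschitzFlow.
Context {R : realType} {n : nat} (e L B : R) (f : 'rV[R]_n -> 'rV[R]_n).
Hypotheses (e0 : 0 < e) (L0 : 0 <= L) (eL : e * L <= 2^-1).
Hypothesis fL : forall x y, `|f x - f y| <= L * `|x - y|.

(** Gronwall for the difference of two solutions. With equal initial values it is uniqueness; in
    general it is Lipschitz dependence on the initial value. *)
Lemma solution_dist (y z : R -> 'rV[R]_n) (A : set R) s t :
  is_interval A -> A s -> A t -> `|t - s| <= e ->
  (forall u : R, A u -> is_derive u 1 y (f (y u))) ->
  (forall u : R, A u -> is_derive u 1 z (f (z u))) ->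
  `|y t - z t| <= 2 * `|y s - z s|.
Proof.
move=> iA As At ste dy dz.
apply: (@short_gronwall _ _ (fun u => y u - z u)
  (fun u => f (y u) - f (z u)) A _ _ L) => //.
- by apply: le_trans eL; rewrite ler_wpM2r.
- by move=> u Au; apply: is_deriveB; [exact: dy|exact: dz].
Qed.

Hypothesis fB : forall x, `|f x| <= B.

Lemma lipschitz_flow : exists phi : R -> 'rV[R]_n -> 'rV[R]_n,
  [/\ forall p, phi 0 p = p,
     forall p (t : R), `|t| < e -> is_derive t 1 (phi ^~ p) (f (phi t p)),
     forall p s t, `|s| < e -> `|t| < e -> `|s + t| < e ->
       phi s (phi t p) = phi (s + t) p &
     forall p q s t, `|s| < e -> `|t| < e ->
       `|phi s p - phi t q| <= B * `|s - t| + 2 * `|p - q| ].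
Proof.
have /choice[Y YP] p := picard p e0 L0 eL fL fB.
have iA : is_interval [set u : R | `|u| < e].
  move=> a b /=; rewrite !ltr_norml => /andP[? ?] /andP[? ?] c /andP[? ?].
  by rewrite ltr_norml; lra.
have A0 : [set u : R | `|u| < e] 0 by rewrite /= normr0.
exists (fun t p => Y p t); split.
- by move=> p; case: (YP p).
- by move=> p; case: (YP p).
- move=> p s t se te ste; have [Y0 dY] := YP p.
  have [Z0 dZ] := YP (Y p t).
  apply/eqP; rewrite -subr_eq0 -normr_le0.
  (* On this interval [Y (Y p t) u] and [Y p (u + t)] both solve the equation in [u], and they agree
     at 0. *)
  pose A := [set u : R | `|u| < e /\ `|u + t| < e].
  have iA' : is_interval A.
    move=> a b [+ +] [+ +] c /andP[? ?].
    rewrite /A /= !ltr_norml => /andP[? ?] /andP[? ?] /andP[? ?] /andP[? ?].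
    by split; lra.
  have := @solution_dist (Y (Y p t)) (fun u => Y p (u + t)) A 0 s iA'.
  rewrite add0r Z0 subrr normr0 mulr0; apply.
  + by rewrite /A /= normr0 add0r.
  + by [].
  + by rewrite subr0 ltW.
  + by move=> u [ue _]; exact: dZ.
  + move=> u [_ ue]; exact: is_derive_translate (dY _ ue).
- move=> p q s t se te.
  have -> : Y p s - Y q t = (Y p s - Y p t) + (Y p t - Y q t) by rewrite addrA subrK.
  apply: (le_trans (ler_normD _ _)); apply: lerD.
    have [Y0 dY] := YP p.
    apply: (derive_bound_abs (le_trans (normr_ge0 _) (fB 0)) iA te se dY).
    by move=> *; exact: fB.
  have [Y0 dY] := YP p; have [Z0 dZ] := YP q.
  rewrite -{2}Y0 -{2}Z0.
  apply: (solution_dist iA A0 te _ dY dZ).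
  by rewrite subr0 ltW.
Qed.

End LipschitzFlow.

(** * The flow of a vector field on a manifold *)

Lemma near_between (R : realType) (a b t : R) : a < t < b ->
  \forall u \near t, a < u < b.
Proof. by move=> tab; apply: (@near_in_itvoo R a b t); rewrite in_itv. Qed.

Section Flow.
Context {R : realType} {n : nat} {M : topologicalType}.
Variables (A : set (chart R n M)) (X : chart R n M -> M -> 'rV[R]_n).
Hypothesis hM : hausdorff_space M.
Hypothesis smA : smooth_atlas A.
Hypothesis smX : smooth_vector_field A X.

Lemma img_fwd (c : chart R n M) x : dom c x -> img c (fwd c x).
Proof. by move=> cx; exists x. Qed.

Lemma dom_bwd (c : chart R n M) y : A c -> img c y -> dom c (bwd c y).
Proof. by case: smA => /(_ c) ch _ _ /ch[_ _ K _ _] [x cx <-]; rewrite K. Qed.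

Lemma bwdK (c : chart R n M) y : A c -> img c y -> fwd c (bwd c y) = y.
Proof. by case: smA => /(_ c) ch _ _ /ch[_ _ K _ _] [x cx <-]; rewrite K. Qed.

Lemma fwdK (c : chart R n M) x : A c -> dom c x -> bwd c (fwd c x) = x.
Proof. by case: smA => /(_ c) ch _ _ /ch[_ _ K _ _]; exact: K. Qed.

Lemma field_locally_lipschitz c x : A c -> dom c x ->
  exists r L, [/\ 0 < r, 0 <= L, (forall y, `|y - fwd c x| <= r -> img c y) &
    forall y z, `|y - fwd c x| <= r -> `|z - fwd c x| <= r ->
      `|X c (bwd c y) - X c (bwd c z)| <= L * `|y - z|].
Proof.
move=> Ac cx; have [/(_ c Ac)[_ oi _ _ _] _ _] := smA.
by apply: (C1_locally_lipschitz oi (img_fwd cx)); case: smX => _ /(_ c Ac 1%N).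
Qed.

Lemma integral_curve_sub a b a' b' g : a <= a' -> b' <= b ->
  integral_curve A X a b g -> integral_curve A X a' b' g.
Proof.
move=> aa bb ig t /andP[at' tb]; apply: ig.
by rewrite (le_lt_trans aa at') (lt_le_trans tb bb).
Qed.

Lemma integral_curve_translate a b s g : integral_curve A X a b g ->
  integral_curve A X (a - s) (b - s) (fun u => g (u + s)).
Proof.
move=> ig t tab; have [|cg dg] := ig (t + s); first by move: tab; rewrite ltrBlDr ltrBrDr.
split=> [|c Ac cc].
  apply: (@continuous_comp _ _ _ (fun u => u + s) g) => //.
  by apply: cvgD => //; exact: cvg_cst.
exact: is_derive_translate (dg c Ac cc).
Qed.

(** The conditions at [t] depend only on the germ of the curve, which is what piecewise definitions
    require. *)
Lemma integral_curve_near a b g h t : (\near t, g t = h t) ->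
  a < t < b -> integral_curve A X a b g ->
  {for t, continuous h} /\
  (forall c, A c -> dom c (h t) -> is_derive t 1 (fwd c \o h) (X c (h t))).
Proof.
move=> gh tab /(_ t tab)[cg dg]; have gt : g t = h t := nbhs_singleton gh.
split=> [|c Ac]; last rewrite -gt.
  rewrite /prop_for /continuous_at -gt.
  by apply: cvg_trans cg; apply: near_eq_cvg; apply: filterS gh => u ->.
move=> cc; apply: near_eq_is_derive (dg c Ac cc).
by apply: filterS gh => u /= ->.
Qed.

(** In a chart around the common point the field is Lipschitz, so the difference of the two curves
    satisfies the linear inequality of [short_gronwall] with initial value 0. *)
Lemma integral_curve_local_uniq a b g h t0 : a < t0 < b ->
  integral_curve A X a b g -> integral_curve A X a b h -> g t0 = h t0 ->
  \forall t \near t0, g t = h t.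
Proof.
move=> t0ab ig ih gh0; have [chA /(_ (g t0))[c Ac cg0] _] := smA.
have [r [L [r0 L0 rimg FL]]] := field_locally_lipschitz Ac cg0.
have [odc oic K cf cb] := chA c Ac.
pose nice (k : R -> M) t :=
  [/\ a < t < b, dom c (k t) & `|fwd c (k t) - fwd c (g t0)| <= r].
have good k : integral_curve A X a b k -> k t0 = g t0 ->
    \forall t \near t0, nice k t.
  move=> ik k0; have [ck _] := ik t0 t0ab.
  have N : nbhs (g t0) [set x | dom c x /\ `|fwd c x - fwd c (g t0)| <= r].
    apply: filterI; first exact: open_nbhs_nbhs.
    by have /cvgrPdistC_le/(_ r r0) := cf _ cg0.
  have : \forall t \near t0, dom c (k t) /\ `|fwd c (k t) - fwd c (g t0)| <= r.
    by move: ck; rewrite /prop_for /continuous_at k0 => /(_ _ N).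
  by apply: filterS2 (near_between t0ab) => t tab [].
have /nbhs_ballP[d /= d0 dP] : \forall t \near t0, nice g t /\ nice h t.
  by apply: filterI; [exact: good|exact: good].
(* The first bound keeps both curves in the good part of the chart, the second makes [e * L] at most
   1/2. *)
pose e := Num.min d (2 * (L + 1))^-1.
have e0 : 0 < e by rewrite lt_min d0/= invr_gt0 mulr_gt0// ltr_pwDr.
apply/nbhs_ballP; exists e => // t te.
pose B := [set u : R | `|t0 - u| < e].
have BP u : B u -> nice g u /\ nice h u.
  by move=> Bu; apply: dP; rewrite -ball_normE /= (lt_le_trans Bu)// ge_min lexx.
have Bt : B t by move: te; rewrite -ball_normE.
have B0 : B t0 by rewrite /B /= subrr normr0.
have iB : is_interval B.
  move=> x y; rewrite /B /= !ltr_distl => /andP[? ?] /andP[? ?] z /andP[? ?].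
  by rewrite ltr_distl; lra.
have W := @short_gronwall _ _ (fun u => fwd c (g u) - fwd c (h u))
  (fun u => X c (g u) - X c (h u)) B t0 t L L0 iB B0 Bt.
have {}W : `|fwd c (g t) - fwd c (h t)| <= 2 * `|fwd c (g t0) - fwd c (h t0)|.
  apply: W.
  - have : `|t - t0| < (2 * (L + 1))^-1.
      by rewrite distrC (lt_le_trans Bt)// ge_min lexx orbT.
    move=> /ltW /(ler_wpM2r L0) /le_trans; apply.
    by rewrite ler_pdivrMl ?mulr_gt0 ?ltr_pwDr//; lra.
  - move=> u /BP[[uab gu _] [_ hu _]].
    by apply: is_deriveB; [apply: (ig u uab).2|apply: (ih u uab).2].
  - move=> u /BP[[uab gu gr] [_ hu hr]].
    by have := FL _ _ gr hr; rewrite !fwdK.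
have [[_ gt _] [_ ht _]] := BP t Bt.
move: W; rewrite gh0 subrr normr0 mulr0 normr_le0 subr_eq0 => /eqP E.
by rewrite -(fwdK Ac gt) E fwdK.
Qed.

(** The times of agreement form a nonempty subset of a connected interval. It is open by local
    uniqueness and relatively closed because [M] is Hausdorff. *)
Lemma integral_curve_uniq a b g h t0 t : a < t0 < b -> a < t < b ->
  integral_curve A X a b g -> integral_curve A X a b h -> g t0 = h t0 ->
  g t = h t.
Proof.
move=> t0ab tab ig ih gh0.
pose I := [set u : R | a < u < b]; pose B := [set u : R | I u /\ g u = h u].
have oI u : I u -> nbhs u I by exact: near_between.
have /connected_intervalP cI : is_interval I.
  by move=> x y /= /andP[? ?] /andP[? ?] z /andP[? ?]; rewrite /I /=; lra.
suff : B = I by move=> BI; have : I t by []; rewrite -BI => -[].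
apply: cI; first by exists t0.
- exists B; last by apply/seteqP; split=> [u [Iu e]|u [_ []]]; split.
  rewrite openE => u [Iu e].
  apply: filterS2 (oI u Iu) (integral_curve_local_uniq Iu ig ih e).
  by move=> v; split.
- exists (~` [set u : R | I u /\ g u <> h u]); last first.
    apply/seteqP; split=> u [Iu e]; split=> //; first by move=> [].
    by apply: contrapT => ne; apply: e.
  apply: open_closedC; rewrite openE => u [Iu ne].
  have hM' := hM; rewrite open_hausdorff in hM'.
  have [[P Q] [/= gP hQ]] := hM' _ _ (introN eqP ne).
  move=> [/= oP oQ PQ]; rewrite !inE in gP hQ.
  have [cg _] := ig u Iu; have [ch _] := ih u Iu.
  have nP : \forall v \near u, P (g v) by apply: cg; exact: open_nbhs_nbhs.
  have nQ : \forall v \near u, Q (h v) by apply: ch; exact: open_nbhs_nbhs.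
  apply: filterS3 (oI u Iu) nP nQ => v Iv Pv Qv; split=> // e.
  have : (P `&` Q) (g v) by split=> //; rewrite e.
  by have /eqP -> := PQ.
Qed.

Lemma integral_curve_glue a b a' b' g h t0 : a < t0 < b -> a' < t0 < b' ->
  integral_curve A X a b g -> integral_curve A X a' b' h -> g t0 = h t0 ->
  exists k, [/\ integral_curve A X (Num.min a a') (Num.max b b') k,
    forall t, a < t < b -> k t = g t & forall t, a' < t < b' -> k t = h t].
Proof.
move=> t0ab t0ab' ig ih gh0.
have agree t : a < t < b -> a' < t < b' -> g t = h t.
  move=> tab tab'.
  have i1 : integral_curve A X (Num.max a a') (Num.min b b') g.
    by apply: integral_curve_sub ig; rewrite ?le_max ?ge_min lexx.
  have i2 : integral_curve A X (Num.max a a') (Num.min b b') h.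
    by apply: integral_curve_sub ih; rewrite ?le_max ?ge_min lexx orbT.
  apply: integral_curve_uniq i1 i2 gh0; rewrite gt_max lt_min.
  - by move: t0ab t0ab' => /andP[-> ->] /andP[-> ->].
  - by move: tab tab' => /andP[-> ->] /andP[-> ->].
(* Near every time of the union [k] coincides with one of the two curves: with [g] inside its
   interval and with [h] elsewhere, uniqueness taking care of the overlap. *)
pose k t := if (a < t < b) then g t else h t.
have kg t : a < t < b -> k t = g t by rewrite /k => ->.
have kh t : a' < t < b' -> k t = h t.
  by rewrite /k; case: ifP => // tab tab'; exact: agree.
exists k; split=> // t tab.
have [tI|tI] := boolP (a < t < b).
  apply: (integral_curve_near _ tI ig).
  by apply: filterS (near_between tI) => u /kg ->.
have tI' : a' < t < b'.
  have /andP[a0 b0] := t0ab; have /andP[a0' b0'] := t0ab'.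
  move: tab tI; rewrite gt_min lt_max negb_and -!leNgt.
  move=> /andP[/orP[?|?] /orP[?|?]] /orP[?|?]; lra.
apply: (integral_curve_near _ tI' ih).
by apply: filterS (near_between tI') => u /kh ->.
Qed.

Local Notation flow := (flow A X).

(** The two curves through [x] are glued and time is shifted by [s]. Functionality, reversal and
    composition of the flow all follow from this one law. *)
Lemma flow_diff s t x y z : flow s x y -> flow t x z -> flow (t - s) y z.
Proof.
move=> [a [b [g [ab sab ig g0 gs]]]] [a' [b' [h [ab' tab ih h0 ht]]]].
have [k [ik kg kh]] := integral_curve_glue ab ab' ig ih (etrans g0 (esym h0)).
exists (Num.min a a' - s), (Num.max b b' - s), (fun u => k (u + s)).
have lem (u : R) : a < u < b -> Num.min a a' < u < Num.max b b'.
  by rewrite gt_min lt_max => /andP[-> ->].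
have lem' (u : R) : a' < u < b' -> Num.min a a' < u < Num.max b b'.
  by rewrite gt_min lt_max => /andP[-> ->]; rewrite !orbT.
split.
- by have /andP[] := lem _ sab; rewrite subr_lt0 subr_gt0 => -> ->.
- by have /andP[] := lem' _ tab; rewrite !ltrD2r => -> ->.
- exact: integral_curve_translate.
- by rewrite add0r kg.
- by rewrite subrK kh.
Qed.

Lemma flow_fun t x y z : flow t x y -> flow t x z -> y = z.
Proof.
move=> fy fz; have := flow_diff fy fz; rewrite subrr.
by move=> [a [b [g [_ _ _ <- <-]]]].
Qed.

Lemma flow_start t x y : flow t x y -> flow 0 x x.
Proof.
by move=> [a [b [g [ab tab ig g0 gt]]]]; exists a, b, g.
Qed.

Lemma flow_opp t x y : flow t x y -> flow (- t) y x.
Proof. by move=> f; have := flow_diff f (flow_start f); rewrite sub0r. Qed.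

Lemma flow_trans s t x y z : flow s x y -> flow t y z -> flow (s + t) x z.
Proof. by move=> /flow_opp f1 f2; rewrite addrC -[s]opprK; exact: flow_diff f1 f2. Qed.

Lemma flow_between s t x y : 0 <= s <= t -> flow t x y ->
  exists2 z, flow s x z & flow (t - s) z y.
Proof.
move=> /andP[s0 st] f; have [a [b [g [ab tab ig g0 gt]]]] := f.
have fs : flow s x (g s).
  exists a, b, g; split=> //; move: ab tab => /andP[? ?] /andP[? ?].
  by rewrite (lt_le_trans _ s0)// (le_lt_trans st).
by exists (g s) => //; exact: flow_diff fs f.
Qed.

End Flow.

(** * Flowing each point for its own time *)

Section PushAlongFlow.
Context {R : realType} {n : nat} (e B k h : R).
Variables (phi : R -> 'rV[R]_n -> 'rV[R]_n) (theta : 'rV[R]_n -> R).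
Hypotheses (B0 : 0 <= B) (k0 : 0 <= k) (kB : k * B <= 2^-1) (h0 : 0 <= h) (he : h < e).
Hypothesis phi0 : forall p, phi 0 p = p.
Hypothesis phiD : forall p s t, `|s| < e -> `|t| < e -> `|s + t| < e ->
  phi s (phi t p) = phi (s + t) p.
Hypothesis phiL : forall p q s t, `|s| < e -> `|t| < e ->
  `|phi s p - phi t q| <= B * `|s - t| + 2 * `|p - q|.
Hypothesis theta_bd : forall p, 0 <= theta p <= h.
Hypothesis thetaL : forall p q, `|theta p - theta q| <= k * `|p - q|.

(** Points [p] and [q] with the same image lie on one trajectory, so their distance is at most [B]
    times the difference of their times, which is at most [k] times their distance; [k * B <= 2^-1]
    forces equality. Surjectivity comes from the intermediate value theorem. *)
Lemma push_homeo : exists g : 'rV[R]_n -> 'rV[R]_n,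
  [/\ continuous (fun p => phi (theta p) p), continuous g,
     cancel (fun p => phi (theta p) p) g & cancel g (fun p => phi (theta p) p)].
Proof.
have e0 : 0 < e := le_lt_trans h0 he.
have sm s : 0 <= s <= h -> `|s| < e.
  by move=> /andP[s0 sh]; rewrite ger0_norm// (le_lt_trans sh).
have smN s : 0 <= s <= h -> `|- s| < e by move=> /sm; rewrite normrN.
have phiK s p : 0 <= s <= h -> phi (- s) (phi s p) = p.
  by move=> sh; rewrite phiD ?addNr ?phi0 ?(sm _ sh) ?(smN _ sh) ?normr0.
have phiNK s p : 0 <= s <= h -> phi s (phi (- s) p) = p.
  by move=> sh; rewrite phiD ?addrN ?phi0 ?(sm _ sh) ?(smN _ sh) ?normr0.
have inj : injective (fun p => phi (theta p) p).
  move=> p q E; have tp := theta_bd p; have tq := theta_bd q.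
  pose w := phi (theta p) p.
  have pE : p = phi (- theta p) w by rewrite phiK.
  have qE : q = phi (- theta q) w by rewrite /w E phiK.
  have H1 : `|p - q| <= B * `|theta p - theta q|.
    rewrite {1}pE {1}qE (le_trans (phiL _ _ (smN _ tp) (smN _ tq)))//.
    by rewrite subrr normr0 mulr0 addr0 opprK addrC distrC.
  have H2 : `|theta p - theta q| <= 2^-1 * `|theta p - theta q|.
    apply: (le_trans (thetaL p q)); apply: (le_trans (ler_wpM2l k0 H1)).
    by rewrite mulrA ler_wpM2r.
  have H3 : `|theta p - theta q| = 0 by have := normr_ge0 (theta p - theta q); lra.
  by move: H1; rewrite H3 mulr0 normr_le0 subr_eq0 => /eqP.
(* The preimage of [q] is sought backward on its trajectory: a time [s] is needed that equals the
   displacement of the point [phi (- s) q]. The function [G] has opposite signs at 0 and [h];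
   clamping makes it continuous on the whole line. *)
have surj q : exists s, 0 <= s <= h /\ theta (phi (- s) q) = s.
  pose c (s : R) := clamp h s.
  have ch s : `|- c s| < e by rewrite normrN (le_lt_trans (clamp_norm s h0)).
  pose G s := s - theta (phi (- c s) q).
  have cG : continuous G.
    apply: (@lipschitz_continuous _ _ _ _ (1 + 2^-1)) => [|s t]; first by lra.
    have T1 := thetaL (phi (- c s) q) (phi (- c t) q).
    have T2 : `|phi (- c s) q - phi (- c t) q| <= B * `|s - t|.
      apply: (le_trans (phiL _ _ (ch s) (ch t))).
      rewrite subrr normr0 mulr0 addr0 ler_wpM2l// opprK addrC distrC.
      exact: clamp_lipschitz.
    have T3 : k * `|phi (- c s) q - phi (- c t) q| <= 2^-1 * `|s - t|.
      by apply: (le_trans (ler_wpM2l k0 T2)); rewrite mulrA ler_wpM2r.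
    rewrite /G opprD addrACA (le_trans (ler_normD _ _))// mulrDl mul1r lerD2l.
    by rewrite -opprD normrN (le_trans T1).
  have [||s] := @IVT R G 0 h 0 h0.
  - exact: continuous_subspaceT.
  - have /andP[t1 t2] := theta_bd (phi (- c 0) q).
    have /andP[t3 t4] := theta_bd (phi (- c h) q).
    by rewrite ge_min le_max /G; apply/andP; split; apply/orP; [left|right]; lra.
  rewrite in_itv/= => /andP[s0 sh] /eqP; rewrite subr_eq0 => /eqP sE.
  exists s; split; first by rewrite s0.
  by move: sE; rewrite /c clamp_id ?ger0_norm.
have /choice[s sP] := surj.
(* The times satisfy an inequality with themselves on both sides, with coefficient 1/2 on the right.
   Absorbing that term bounds their difference by [4 * k] times the distance of [q] and [q']. *)
have gL : forall q q', `|phi (- s q) q - phi (- s q') q'| <= (4 * k * B + 2) * `|q - q'|.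
  move=> q q'; have [sq sqE] := sP q; have [sq' sqE'] := sP q'.
  have H1 := phiL q q' (smN _ sq) (smN _ sq').
  have E : `|- s q - - s q'| = `|s q - s q'| by rewrite opprK addrC distrC.
  rewrite E in H1.
  have H2 := thetaL (phi (- s q) q) (phi (- s q') q').
  rewrite sqE sqE' in H2.
  have H3 := le_trans H2 (ler_wpM2l k0 H1).
  have H4 : k * B * `|s q - s q'| <= 2^-1 * `|s q - s q'| by rewrite ler_wpM2r.
  have H5 : `|s q - s q'| <= 4 * k * `|q - q'| by lra.
  by apply: (le_trans H1); have := ler_wpM2l B0 H5; lra.
exists (fun q => phi (- s q) q); split.
- apply: (@lipschitz_continuous _ _ _ _ (B * k + 2)) => [|p q].
    by rewrite addr_ge0// mulr_ge0.
  apply: (le_trans (phiL _ _ (sm _ (theta_bd p)) (sm _ (theta_bd q)))).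
  by have := ler_wpM2l B0 (thetaL p q); lra.
- apply: (lipschitz_continuous _ gL).
  by rewrite addr_ge0// !mulr_ge0.
- move=> p; apply: inj; have [sp spE] := sP (phi (theta p) p).
  by rewrite spE phiNK.
- by move=> q; have [sq sqE] := sP q; rewrite /= sqE phiNK.
Qed.

End PushAlongFlow.

(** * Extending a map supported in a compact set by the identity *)

Section ExtendHomeo.
Context {Z M : topologicalType} (U B : set Z) (h : Z -> M).
Hypothesis hM : hausdorff_space M.
Hypothesis injh : forall x y, U x -> U y -> h x = h y -> x = y.
Hypothesis conth : forall x, U x -> {for x, continuous h}.
Hypothesis openh : forall O, open O -> O `<=` U -> open (h @` O).
Hypotheses (oU : open U) (cB : compact B) (BU : B `<=` U).

Lemma compact_image : compact (h @` B).
Proof.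
apply: continuous_compact cB; apply: continuous_in_subspaceT => x.
by rewrite inE => /BU; exact: conth.
Qed.

(** [s] is transported by [h] to the image of [U] and completed by the identity. The two
    prescriptions are compatible because [s] is the identity on [U] off [B]. *)
Lemma extend_by_id (s : Z -> Z) :
  (forall x, U x -> U (s x)) -> (forall x, U x -> {for x, continuous s}) ->
  (forall x, U x -> ~ B x -> s x = x) ->
  exists g : M -> M, [/\ continuous g, forall x, U x -> g (h x) = h (s x) &
    forall y, ~ (h @` B) y -> g y = y].
Proof.
move=> sU cs sB.
have /choice[g gP] : forall y, exists z, (forall x, U x -> h x = y -> z = h (s x)) /\
    (~ (h @` B) y -> z = y).
  move=> y; have [[x Ux hx]|no] := pselect (exists2 x, U x & h x = y).
    exists (h (s x)); split=> [x' Ux' hx'|nB]; first by rewrite (injh Ux' Ux)// hx hx'.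
    by rewrite sB// => Bx; apply: nB; exists x.
  by exists y; split=> // x Ux hx; case: no; exists x.
exists g; have gh x : U x -> g (h x) = h (s x).
  by move=> Ux; have [/(_ x Ux erefl) -> _] := gP (h x).
split=> //; last by move=> y; have [_] := gP y; exact.
move=> y; have [[x Ux <-]|no] := pselect (exists2 x, U x & h x = y).
  move=> W; rewrite gh// => nW.
  have : nbhs x [set x | U x /\ W (h (s x))].
    apply: filterI; first exact: open_nbhs_nbhs.
    exact: ((cs _ Ux) _ (conth (sU _ Ux) nW)).
  rewrite nbhsE; move=> [V [oV Vx] VW].
  change (nbhs (h x) (g @^-1` W)); apply: (@filterS _ _ _ (h @` V)).
    by move=> _ [z Vz <-]; have [Uz] := VW z Vz; rewrite /= gh.
  apply: open_nbhs_nbhs; split; last by exists x.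
  by apply: openh => // z /VW[].
(* Outside the image of [U] the map is the identity near [y], because the compact image of [B] is
   closed in the Hausdorff space [M]. *)
have nB : ~ (h @` B) y by move=> [x Bx hx]; apply: no; exists x => //; exact: BU.
have E : g y = y by have [_] := gP y; exact.
rewrite /continuous_at E.
apply: (@cvg_trans _ (id @ y)); last exact: cvg_id.
apply: near_eq_cvg.
have oB : open (~` (h @` B)) by apply: closed_openC; apply: compact_closed hM compact_image.
by apply: filterS (open_nbhs_nbhs (conj oB nB)) => z nz; have [_ ->] := gP z.
Qed.

Lemma extend_homeo (s s' : Z -> Z) :
  (forall x, U x -> U (s x)) -> (forall x, U x -> {for x, continuous s}) ->
  (forall x, U x -> ~ B x -> s x = x) ->
  (forall x, U x -> U (s' x)) -> (forall x, U x -> {for x, continuous s'}) ->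
  (forall x, U x -> ~ B x -> s' x = x) ->
  (forall x, U x -> s' (s x) = x) -> (forall x, U x -> s (s' x) = x) ->
  exists g g' : M -> M, [/\ continuous g /\ continuous g', cancel g g' /\ cancel g' g,
    forall x, U x -> g (h x) = h (s x), forall x, U x -> g' (h x) = h (s' x) &
    forall y, ~ (h @` B) y -> g y = y /\ g' y = y].
Proof.
move=> sU cs sB s'U cs' s'B sK s'K.
have [g [cg gh gB]] := extend_by_id sU cs sB.
have [g' [cg' g'h g'B]] := extend_by_id s'U cs' s'B.
exists g, g'; split=> //; last by move=> y nB; rewrite gB// g'B.
split=> y; have [[x Bx <-]|nB] := pselect ((h @` B) y).
- by have Ux := BU Bx; rewrite gh// g'h ?sK//; exact: sU.
- by rewrite gB// g'B.
- by have Ux := BU Bx; rewrite g'h// gh ?s'K//; exact: s'U.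
- by rewrite g'B// gB.
Qed.

End ExtendHomeo.

Section Retract.
Context {R : realType} {n : nat}.
Implicit Types p x y : 'rV[R]_n.

(** Balls of the maximum norm are cubes, so clamping coordinates is a 1-Lipschitz retraction onto
    the closed ball. Precomposing with it turns a field that is Lipschitz on the ball into a global
    one. *)
Definition cube_retract (r : R) p x := p + \row_j clamp r ((x - p) ord0 j).

Lemma cube_retract_in r p x : 0 <= r -> `|cube_retract r p x - p| <= r.
Proof.
move=> r0; rewrite /cube_retract addrAC subrr add0r.
by apply: rV_norm_le => // j; rewrite mxE; exact: clamp_norm.
Qed.

Lemma cube_retract_id r p x : `|x - p| <= r -> cube_retract r p x = x.
Proof.
move=> xr; apply/rowP => j; rewrite /cube_retract 2!mxE clamp_id.
  by rewrite !mxE addrC subrK.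
by rewrite (le_trans (rV_coord_le _ _)).
Qed.

Lemma cube_retract_lipschitz r p x y : 0 <= r ->
  `|cube_retract r p x - cube_retract r p y| <= `|x - y|.
Proof.
move=> r0; rewrite /cube_retract opprD addrACA subrr add0r.
apply: rV_norm_le => // j; rewrite !mxE (le_trans (clamp_lipschitz _ _ r0))//.
have := rV_coord_le (x - y) j; rewrite !mxE; congr (`|_| <= _); ring.
Qed.

End Retract.

(** * The flow in a chart and a single local push *)

Section LocalFlow.
Context {R : realType} {n : nat} {M : topologicalType}.
Variables (A : set (chart R n M)) (X : chart R n M -> M -> 'rV[R]_n).
Hypothesis hM : hausdorff_space M.
Hypothesis smA : smooth_atlas A.
Hypothesis smX : smooth_vector_field A X.

(** The field in the chart, precomposed with the retraction onto the ball of radius [2 * r], is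
    bounded and globally Lipschitz. A trajectory from the ball of radius [r] stays for times below
    [e] where the modified field is the true one. *)
Lemma local_flow c x0 (V : set M) : A c -> dom c x0 -> open V -> V x0 ->
  exists r e B (phi : R -> 'rV[R]_n -> 'rV[R]_n),
  [/\ [/\ 0 < r, 0 < e & 0 <= B],
   forall y, `|y - fwd c x0| <= 2 * r -> img c y /\ V (bwd c y),
   forall p t, `|p - fwd c x0| <= r -> `|t| < e -> `|phi t p - fwd c x0| <= 2 * r /\
      flow A X t (bwd c p) (bwd c (phi t p)),
   forall p, phi 0 p = p &
   (forall p s t, `|s| < e -> `|t| < e -> `|s + t| < e ->
       phi s (phi t p) = phi (s + t) p) /\
     (forall p q s t, `|s| < e -> `|t| < e ->
       `|phi s p - phi t q| <= B * `|s - t| + 2 * `|p - q|)].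
Proof.
move=> Ac cx oV Vx; have [/(_ c Ac)[od oi K cf cb] _ tr] := smA.
set p0 := fwd c x0.
have [r1 [L [r1_0 L0 r1img FL]]] := field_locally_lipschitz smA smX Ac cx.
have /nbhs_ballP[d /= d0 dV] : nbhs p0 [set y | V (bwd c y)].
  apply: (cb p0 (img_fwd cx)); rewrite K//; exact: open_nbhs_nbhs.
pose r := Num.min r1 d / 4.
have m0 : 0 < Num.min r1 d by rewrite lt_min r1_0.
have r0 : 0 < r by rewrite divr_gt0.
have r_r1 : 2 * r <= r1.
  have : Num.min r1 d <= r1 by rewrite ge_min lexx.
  by move: m0; rewrite /r; lra.
have r_d : 2 * r < d.
  have : Num.min r1 d <= d by rewrite ge_min lexx orbT.
  by move: m0; rewrite /r; lra.
pose F y := X c (bwd c y); pose f y := F (cube_retract (2 * r) p0 y).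
have r20 : 0 <= 2 * r by rewrite mulr_ge0// ltW.
have fL y z : `|f y - f z| <= L * `|y - z|.
  have R1 w : `|cube_retract (2 * r) p0 w - p0| <= r1.
    by rewrite (le_trans _ r_r1)// cube_retract_in.
  rewrite (le_trans (FL _ _ (R1 y) (R1 z)))// ler_wpM2l//.
  exact: cube_retract_lipschitz.
pose B := `|F p0| + L * (2 * r).
have B0 : 0 <= B by rewrite addr_ge0// mulr_ge0.
have fB y : `|f y| <= B.
  rewrite -[f y](subrK (F p0)) addrC (le_trans (ler_normD _ _))// lerD2l.
  have := FL (cube_retract (2 * r) p0 y) p0; rewrite subrr normr0 => H.
  rewrite (le_trans (H _ _))//; last by rewrite ler_wpM2l// cube_retract_in.
    by rewrite (le_trans _ r_r1)// cube_retract_in.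
  exact: ltW.
(* The first bound gives [e * L <= 2^-1]; by the second, motion at speed at most [B] covers a
   distance at most [r]. *)
pose e := Num.min (2 * (L + 1))^-1 (r / (B + 1)).
have L1 : 0 < L + 1 by rewrite ltr_pwDr.
have B1 : 0 < B + 1 by rewrite ltr_pwDr.
have e0 : 0 < e by rewrite lt_min invr_gt0 mulr_gt0//= divr_gt0.
have eL : e * L <= 2^-1.
  apply: (@le_trans _ _ ((2 * (L + 1))^-1 * L)).
    by rewrite ler_wpM2r// ge_min lexx.
  by rewrite ler_pdivrMl ?mulr_gt0//; lra.
have eB : B * e <= r.
  apply: (@le_trans _ _ (B * (r / (B + 1)))).
    by rewrite ler_wpM2l// ge_min lexx orbT.
  by rewrite mulrA ler_pdivrMr// mulrDr mulr1 mulrC lerDl ltW.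
have [phi [phi0 dphi phiD phiL]] := lipschitz_flow e0 L0 eL fL fB.
have near_phi p t : `|p - p0| <= r -> `|t| < e -> `|phi t p - p0| <= 2 * r.
  move=> pr te; have := phiL p p t 0 te; rewrite normr0 => /(_ e0).
  rewrite phi0 subr0 subrr normr0 mulr0 addr0 => H.
  rewrite -[phi t p](subrK p) -addrA (le_trans (ler_normD _ _))//.
  have := ler_wpM2l B0 (ltW te); lra.
have im y : `|y - p0| <= 2 * r -> img c y by move=> yr; apply: r1img; exact: le_trans r_r1.
exists r, e, B, phi; split=> //.
  move=> y yr; split; first exact: im.
  by apply: dV; rewrite -ball_normE /= distrC (le_lt_trans yr).
move=> p t pr te; split; first exact: near_phi.
exists (- e), e, (fun u => bwd c (phi u p)); split.
- by rewrite oppr_lt0 e0.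
- by rewrite -ltr_norml.
- move=> u; rewrite -ltr_norml => ue; have ur := near_phi p u pr ue.
  have iu := im _ ur; have du := dphi p u ue.
  split.
    apply: (@continuous_comp _ _ _ (phi ^~ p) (bwd c)); last exact: cb.
    exact: is_derive_continuous du.
  (* In another chart the chain rule through the transition map matches the transformation law of
     [X]. *)
  move=> c' Ac' cc'; have cu := dom_bwd smA Ac iu.
  have uE := bwdK smA Ac iu.
  have dtr : differentiable (fwd c' \o bwd c) (phi u p).
    have [dt _] := tr c c' Ac Ac' 1%N; apply: dt.
    by exists (bwd c (phi u p)).
  have := is_derive_comp du dtr.
  have [XE _] := smX; rewrite (XE c c' _ Ac Ac' cu cc') uE.
  by rewrite /f cube_retract_id.
- by rewrite phi0.
- by [].
Qed.

Lemma flow_refl x : flow A X 0 x x.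
Proof.
have [_ /(_ x)[c Ac cx] _] := smA.
have [r [e [B [phi [[r0 e0 B0] _ fl phi0 _]]]]] := local_flow Ac cx openT I.
have := fl (fwd c x) 0; rewrite subrr !normr0 => /(_ (ltW r0) e0)[_].
by rewrite phi0 (fwdK smA Ac cx).
Qed.

Definition reaches x y := exists2 t, 0 <= t & flow A X t x y.

Lemma reaches_refl x : reaches x x.
Proof. by exists 0 => //; exact: flow_refl. Qed.

Lemma reaches_trans x y z : reaches x y -> reaches y z -> reaches x z.
Proof.
move=> [s s0 f] [t t0 g]; exists (s + t); first exact: addr_ge0.
exact: flow_trans f g.
Qed.

Lemma reaches_diff s t x y z : flow A X s x y -> flow A X t x z -> s <= t -> reaches y z.
Proof. by move=> f g st; exists (t - s); [rewrite subr_ge0|exact: flow_diff f g]. Qed.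

(* The displacement [theta] has Lipschitz constant at most 1/2 in time along
   trajectories, hence pushing each point by its own time is a homeomorphism that
   respects the order of trajectories. *)
Lemma push_forward x0 (V : set M) : open V -> V x0 ->
  exists (g g' : M -> M) (B : set M),
  [/\ [/\ continuous g, continuous g', cancel g g' & cancel g' g],
    [/\ closed B, B `<=` V & forall x, ~ B x -> g x = x],
    (forall x, reaches x (g x)),
    (forall x y, reaches x y -> reaches (g x) (g y)) &
    forall a b gamma t0, integral_curve A X a b gamma -> a < t0 < b ->
      gamma t0 = x0 -> exists2 d, 0 < d &
        a < t0 - d /\ t0 + d < b /\ reaches (gamma (t0 + d)) (g (gamma (t0 - d)))].
Proof.
move=> oV Vx0; have [chA /(_ x0)[c Ac cx0] _] := smA.
have [od oi K cf cb] := chA c Ac.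
have [r [e [B [phi [[r0 e0 B0] inV fl phi0 [phiD phiL]]]]]] := local_flow Ac cx0 oV Vx0.
set p0 := fwd c x0 in inV fl.
(* The slope of the bump: the first bound keeps its height [k * r] at most [e / 2], the second makes
   [k * B] at most 1/2. *)
pose k := Num.min (e / (2 * r)) (2 * (B + 1))^-1.
have B1 : 0 < B + 1 by rewrite ltr_pwDr.
have k0 : 0 < k by rewrite lt_min invr_gt0 divr_gt0 ?mulr_gt0.
have kB : k * B <= 2^-1.
  apply: (@le_trans _ _ ((2 * (B + 1))^-1 * B)).
    by rewrite ler_wpM2r// ge_min lexx orbT.
  by rewrite ler_pdivrMl ?mulr_gt0//; lra.
pose h := k * r.
have h0 : 0 <= h by rewrite mulr_ge0// ltW.
have he : h < e.
  have : h <= e / (2 * r) * r by rewrite ler_wpM2r ?(ltW r0)// ge_min lexx.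
  rewrite invfM mulrA mulfVK ?gt_eqF//; lra.
pose theta (p : 'rV[R]_n) := k * Num.max 0 (r - `|p - p0|).
have theta_bd p : 0 <= theta p <= h.
  rewrite /theta mulr_ge0 ?(ltW k0) ?le_max ?lexx//= ler_wpM2l ?(ltW k0)//.
  by rewrite ge_max (ltW r0)/= gerBl.
have theta_out p : r <= `|p - p0| -> theta p = 0.
  by move=> pr; rewrite /theta max_l ?mulr0// subr_le0.
have thetaL p q : `|theta p - theta q| <= k * `|p - q|.
  rewrite -mulrBr normrM (gtr0_norm k0) ler_wpM2l ?(ltW k0)//.
  have H1 : `|p - p0| <= `|p - q| + `|q - p0| by exact: ler_distD.
  have H2 : `|q - p0| <= `|p - q| + `|p - p0| by rewrite (distrC p q); exact: ler_distD.
  have H3 := normr_ge0 (p - q).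
  clear -H1 H2 H3.
  by rewrite ler_norml; case: (leP 0 (r - `|p - p0|)) => ?;
    case: (leP 0 (r - `|q - p0|)) => ?; lra.
have [sg' [cs cs' sK s'K]] :=
  push_homeo B0 (ltW k0) kB h0 he phi0 phiD phiL theta_bd thetaL.
set sg := (fun p => phi (theta p) p) in cs sK s'K.
pose D := [set y : 'rV[R]_n | `|y - p0| <= r].
have te p : `|theta p| < e.
  by have /andP[t0 th] := theta_bd p; rewrite ger0_norm// (le_lt_trans th).
have sgD p : ~ D p -> sg p = p.
  by move=> /negP; rewrite -ltNge => /ltW/theta_out t0; rewrite /sg t0 phi0.
have sg'D p : ~ D p -> sg' p = p.
  by move=> /sgD sp; rewrite -{1}sp sK.
have rr : r <= 2 * r by lra.
have DU : D `<=` img c by move=> y yr; have [] := inV y (le_trans yr rr).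
have sgU p : img c p -> img c (sg p).
  move=> ip; have [/= Dp|/sgD->//] := pselect (D p).
  by have [/inV[]] := fl p _ Dp (te p).
have sg'U p : img c p -> img c (sg' p).
  move=> ip; have [/DU//|nD] := pselect (D (sg' p)).
  by rewrite -(s'K p) sgD// in ip.
have cD : compact D by exact: cball_compact.
have injb x y : img c x -> img c y -> bwd c x = bwd c y -> x = y.
  by move=> ix iy E; rewrite -(bwdK smA Ac ix) E (bwdK smA Ac iy).
have openb W : open W -> W `<=` img c -> open (bwd c @` W).
  move=> oW WU; rewrite openE => _ [y Wy <-].
  have cy := dom_bwd smA Ac (WU y Wy).
  have : nbhs (bwd c y) [set x | dom c x /\ W (fwd c x)].
    apply: filterI; first exact: open_nbhs_nbhs.
    by apply: (cf _ cy); rewrite (bwdK smA Ac (WU y Wy)); exact: open_nbhs_nbhs.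
  by apply: filterS => x [cx Wx]; exists (fwd c x) => //; exact: (fwdK smA Ac cx).
have [g [g' [[cg cg'] [gK g'K] gb g'b gid]]] := extend_homeo hM injb cb openb oi cD DU
  sgU (fun x _ => cs x) (fun x _ => @sgD x) sg'U (fun x _ => cs' x) (fun x _ => @sg'D x)
  (fun x _ => sK x) (fun x _ => s'K x).
(* The displacement time as a function on [M], extended by 0 outside the chart. *)
pose th x := if pselect (dom c x) then theta (fwd c x) else 0.
have thP x : flow A X (th x) x (g x).
  have [[p Dp <-]|nD] := pselect ((bwd c @` D) x).
    have ip := DU p Dp; have cp := dom_bwd smA Ac ip.
    rewrite /th; case: pselect => // ?; rewrite (bwdK smA Ac ip) gb//.
    by have [] := fl p _ Dp (te p).
  rewrite (gid x nD).1 /th; case: pselect => [cx|?]; last exact: flow_refl.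
  rewrite theta_out; first exact: flow_refl.
  rewrite leNgt; apply/negP => /ltW xr; apply: nD; exists (fwd c x) => //.
  exact: (fwdK smA Ac cx).
have th0 x : 0 <= th x.
  by rewrite /th; case: pselect => // cx; have /andP[] := theta_bd (fwd c x).
(* Along a trajectory [th] drops by at most half the elapsed time, so [g x] never overtakes [g y].
   If [t < th x], then [x] lies in the ball of radius [r] and [t < e], so the local flow describes
   the motion. *)
have thL x y t : 0 <= t -> flow A X t x y -> th x <= t + th y.
  move=> t0 xy; have [xt|xt] := leP (th x) t; first by rewrite ler_wpDr.
  have [cx tx] : dom c x /\ th x = theta (fwd c x).
    by move: xt; rewrite /th; case: pselect => // ?; rewrite ltNge t0.
  set p := fwd c x in tx.
  have pr : `|p - p0| <= r.
    rewrite leNgt; apply/negP => /ltW/theta_out; rewrite -tx => E.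
    by move: xt; rewrite E ltNge t0.
  have te' : `|t| < e.
    have /andP[_ ph] := theta_bd p.
    by rewrite ger0_norm// (lt_trans xt)// tx (le_lt_trans ph).
  have [pr2 fp] := fl p t pr te'; rewrite (fwdK smA Ac cx) in fp.
  have yE := flow_fun hM smA smX xy fp; have [ip _] := inV _ pr2.
  have -> : th y = theta (phi t p).
    rewrite yE /th; case: pselect => [?|/(_ (dom_bwd smA Ac ip))//].
    by rewrite (bwdK smA Ac ip).
  have H1 := phiL p p 0 t; rewrite normr0 subrr normr0 mulr0 addr0 sub0r normrN in H1.
  have {}H1 := H1 e0 te'; rewrite phi0 (ger0_norm t0) in H1.
  have H2 := thetaL p (phi t p).
  have H3 := ler_wpM2l (ltW k0) H1.
  have H4 : k * B * t <= 2^-1 * t by rewrite ler_wpM2r.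
  have H5 := ler_norm (theta p - theta (phi t p)).
  by rewrite tx; lra.
exists g, g', (bwd c @` D); split=> //.
- split.
  + exact: compact_closed hM (compact_image cb cD DU).
  + by move=> _ [y yr <-]; have [] := inV y (le_trans yr rr).
  + by move=> x /gid[].
- by move=> x; exists (th x).
- move=> x y [t t0 xy].
  have xgy := flow_trans hM smA smX xy (thP y).
  by apply: reaches_diff (thP x) xgy _; exact: thL.
- move=> a b gamma t0 ig tab gt0; have [cg0 _] := ig t0 tab.
  have thx0 : 2 * (k * r / 2) = theta p0.
    by rewrite /theta subrr normr0 subr0 max_r ?(ltW r0)// mulrC divfK.
  have : \forall t \near t0, a < t < b /\
      (dom c (gamma t) /\ k * r / 2 < theta (fwd c (gamma t))).
    apply: filterI; first exact: near_between.
    rewrite /prop_for /continuous_at gt0 in cg0.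
    apply: (cg0 [set x | dom c x /\ k * r / 2 < theta (fwd c x)]).
    apply: filterI; first exact: open_nbhs_nbhs.
    have ct : {for x0, continuous (theta \o fwd c)}.
      apply: continuous_comp; first exact: cf.
      exact: (lipschitz_continuous (ltW k0) thetaL).
    apply: (cvgr_gt _ ct); rewrite /= -/p0 -thx0.
    have : 0 < k * r by rewrite mulr_gt0.
  by lra.
  move=> /nbhs_ballP[d /= d0 dP].
  (* Near [t0] the displacement exceeds half its peak [k * r]. As [2 * u] is at most that half, the
     point at time [t0 - u] is pushed at least as far as the one at [t0 + u]. *)
  pose u := Num.min (d / 2) (k * r / 4).
  have u0 : 0 < u by rewrite lt_min !divr_gt0// mulr_gt0.
  have ud : u < d.
    have : u <= d / 2 by rewrite ge_min lexx.
  by lra.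
  have uk : 2 * u <= k * r / 2.
    have : u <= k * r / 4 by rewrite ge_min lexx orbT.
  by lra.
  have bm : ball t0 d (t0 - u) by rewrite -ball_normE /= opprB addrC subrK gtr0_norm.
  have bp : ball t0 d (t0 + u).
    by rewrite -ball_normE /= opprD addrA subrr add0r normrN gtr0_norm.
  have [/andP[am mb] [cm tm]] := dP _ bm; have [/andP[ap pb] _] := dP _ bp.
  exists u => //; split=> //; split=> //.
  have f2 : flow A X (2 * u) (gamma (t0 - u)) (gamma (t0 + u)).
    exists (a - (t0 - u)), (b - (t0 - u)), (fun v => gamma (v + (t0 - u))); split.
    + by rewrite subr_lt0 am subr_gt0.
    + by apply/andP; split; lra.
    + exact: integral_curve_translate.
    + by rewrite add0r.
    + by congr gamma; ring.
  apply: (reaches_diff f2 (thP _)).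
  rewrite /th; case: pselect => // ?.
  by rewrite (le_trans uk)// ltW.
Qed.

End LocalFlow.

(** * Compressing compact subsets of the basin *)

(** If [P K] failed, the sets whose complement in [K] satisfies [P] would form a proper filter
    containing [K]. At a cluster point of it, a neighborhood satisfying [P] gives a
    contradiction. *)
Lemma compact_induct (T : topologicalType) (K : set T) (P : set T -> Prop) :
  compact K -> P set0 -> (forall A B, P A -> P B -> P (A `|` B)) ->
  (forall A B, A `<=` B -> P B -> P A) ->
  (forall x, K x -> exists2 N, nbhs x N & P N) -> P K.
Proof.
move=> cK P0 PU PS Ploc; apply: contrapT => nPK.
pose F : set_system T := [set A | P (K `\` A)].
have FF : ProperFilter F.
  split; first by rewrite /F /= setD0.
  split.
  - by rewrite /F /= setDT.
  - by move=> A B FA FB; rewrite /F /= setDIr; exact: PU.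
  - by move=> A B AB; apply: PS => x [Kx nB]; split=> // /AB.
have [|x [Kx clx]] := cK F FF; first by rewrite /F /= setDv.
have [N xN PN] := Ploc x Kx.
have FN : F (~` N) by apply: PS PN => y [_] /contrapT.
by have [y []] := clx _ _ FN xN.
Qed.

Section Basin.
Context {R : realType} {n : nat} {M : topologicalType}.
Variables (A : set (chart R n M)) (X : chart R n M -> M -> 'rV[R]_n) (S : set M).
Hypothesis hM : hausdorff_space M.
Hypothesis smA : smooth_atlas A.
Hypothesis smX : smooth_vector_field A X.
Hypothesis stS : asymptotically_stable A X S.

Local Notation reaches := (reaches A X).
Local Notation D := (domain_of_attraction A X S).

Let reachesT := reaches_trans hM smA smX.
Let reaches0 := reaches_refl smA smX.

Lemma stable_closed : closed S.
Proof. by case: stS => cS _ _ _; exact: compact_closed. Qed.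

Lemma stable_reaches x y : reaches x y -> S y -> S x.
Proof.
move=> [t _ f] Sy; have [_ inv _ _] := stS.
have [_ <-] := inv (- t); exists y => //; exact: (flow_opp hM smA smX f).
Qed.

(** Convergence concerns the tail of the forward trajectory, and moving along the trajectory only
    shifts time. *)
Lemma basin_reaches x y : reaches x y -> D x <-> D y.
Proof.
move=> [t t0 xy]; split=> -[ex lim].
  have shift V s : 0 <= s -> flows_into A X (t + s) x V -> flows_into A X s y V.
    move=> s0 [z Vz xz]; exists z => //.
    by have := flow_diff hM smA smX xy xz; rewrite addrAC subrr add0r.
  split=> [s s0|V SV]; first by apply: shift => //; apply: ex; rewrite addr_ge0.
  have [m [mr mP]] := lim V SV.
  exists (Num.max m 0); split; first exact: num_real.
  move=> s; rewrite gt_max => /andP[ms s0]; apply: shift; first exact: ltW.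
  by apply: mP; rewrite ltr_wpDl.
have shift V s : t <= s -> flows_into A X (s - t) y V -> flows_into A X s x V.
  move=> ts [z Vz yz]; exists z => //.
  by have := flow_trans hM smA smX xy yz; rewrite addrC subrK.
split=> [s s0|V SV].
  have [st|ts] := leP s t; last first.
    by apply: shift; [exact: ltW|apply: ex; rewrite subr_ge0 ltW].
  have [|z xz _] := flow_between hM smA smX (s := s) _ xy; first by rewrite s0.
  by exists z.
have [m [mr mP]] := lim V SV.
exists (Num.max m 0 + t); split; first exact: num_real.
move=> s ms; have {ms} : Num.max m 0 < s - t by rewrite ltrBrDr.
rewrite gt_max subr_gt0 => /andP[ms ts].
by apply: shift; [exact: ltW|exact: mP].
Qed.

(** Lyapunov stability with open sets and [reaches]; iterating it provides nested safety margins
    around [S]. *)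
Lemma stable_core V : open V -> S `<=` V -> exists W,
  [/\ open W, S `<=` W & forall x y, W x -> reaches x y -> V y].
Proof.
move=> oV SV; have [_ _ _ lyap] := stS.
have [|U SU UV] := lyap V.
  by move=> x Sx; apply: open_nbhs_nbhs; split=> //; exact: SV.
exists (interior U); split; first exact: open_interior.
  by move=> x Sx; exact: SU.
move=> x y /interior_subset Ux [t t0 xy].
by have [z Vz xz] := UV x t Ux t0; rewrite (flow_fun hM smA smX xy xz).
Qed.

Lemma basin_entry x V : D x -> open V -> S `<=` V -> exists t y,
  [/\ 0 <= t, V y & flow A X t x y].
Proof.
move=> [_ lim] oV SV; have [|m [mr mP]] := lim V.
  by move=> y Sy; apply: open_nbhs_nbhs; split=> //; exact: SV.
have [|y Vy xy] := mP (`|m| + 1); last first.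
  by exists (`|m| + 1), y; split=> //; rewrite addr_ge0.
by rewrite (le_lt_trans (ler_norm m))// ltrDl.
Qed.

(** Stronger than lying in [V]: it persists along forward trajectories, so later pushes cannot undo
    it. *)
Definition captured (V : set M) x := forall y, reaches x y -> V y.

Lemma captured_reaches V x y : captured V x -> reaches x y -> captured V y.
Proof. by move=> cV xy z /(reachesT xy)/cV. Qed.

(** The features of a single local push that survive composition. The neighborhood of [S] left fixed
    is what later keeps embeddings unchanged near the zero section. *)
Definition forward_push (g g' : M -> M) :=
  [/\ [/\ continuous g, continuous g', cancel g g' & cancel g' g],
    exists N, [/\ open N, S `<=` N & forall x, N x -> g x = x],
    forall x, reaches x (g x) &
    forall x y, reaches x y -> reaches (g x) (g y)].

Lemma forward_push_id : forward_push id id.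
Proof.
split=> //; first by split=> // x; exact: cvg_id.
by exists setT; split=> //; exact: openT.
Qed.

Lemma forward_push_comp g g' f f' : forward_push g g' -> forward_push f f' ->
  forward_push (f \o g) (g' \o f').
Proof.
move=> [[cg cg' gK g'K] [N [oN SN Nid]] gr gm] [[cf cf' fK f'K] [N' [oN' SN' N'id]] fr fm].
split.
- split.
  + by move=> x; apply: continuous_comp; [exact: cg|exact: cf].
  + by move=> x; apply: continuous_comp; [exact: cf'|exact: cg'].
  + by move=> x /=; rewrite fK.
  + by move=> x /=; rewrite g'K.
- exists (N `&` N'); split; first exact: openI.
    by move=> x Sx; split; [exact: SN|exact: SN'].
  by move=> x [Nx N'x] /=; rewrite Nid// N'id.
- by move=> x; exact: reachesT (gr x) (fr _).
- by move=> x y /gm/fm.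
Qed.

Lemma curve_reaches a b gamma s t : integral_curve A X a b gamma ->
  a < s -> t < b -> s <= t -> reaches (gamma s) (gamma t).
Proof.
move=> ig sa tb st; exists (t - s); first by rewrite subr_ge0.
exists (a - s), (b - s), (fun u => gamma (u + s)); split.
- by rewrite subr_lt0 sa subr_gt0 (le_lt_trans st).
- by apply/andP; split; lra.
- exact: integral_curve_translate.
- by rewrite add0r.
- by rewrite subrK.
Qed.

(** A supremum argument along the trajectory from [x] to a time [T] at which it is deep inside [V]:
    the times [t] such that some push carries [x] to or beyond [gamma t] are shown to include
    [T]. *)
Lemma push_point x V : D x -> open V -> S `<=` V ->
  exists g g', forward_push g g' /\ captured V (g x).
Proof.
move=> Dx oV SV; have [V2 [oV2 SV2 V2V]] := stable_core oV SV.
have [Sx|nSx] := pselect (S x).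
  by exists id, id; split; [exact: forward_push_id|move=> y; apply: V2V; exact: SV2].
(* Two margins are used: a push carrying [x] to or beyond a point of [V3] lands in [V2], and from
   [V2] trajectories stay in [V]. *)
have [V3 [oV3 SV3 V3V2]] := stable_core oV2 SV2.
have [T [y [T0 V3T [a [b [gamma [/andP[a0 b0] /andP[aT Tb] ig g0 gT]]]]]]] :=
  basin_entry Dx oV3 SV3.
rewrite -gT in V3T.
pose Q t := exists g g', forward_push g g' /\ reaches (gamma t) (g x).
suff [g [g' [gp rT]]] : Q T.
  by exists g, g'; split=> // z; apply: V2V; exact: V3V2 V3T rT.
pose E := [set t | 0 <= t <= T /\ Q t].
have E0 : E 0.
  split; first by rewrite lexx.
  by exists id, id; rewrite g0; split; [exact: forward_push_id|exact: reaches0].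
have supE : has_sup E by split; [exists 0|exists T => t [/andP[]]].
pose t1 := sup E.
have t10 : 0 <= t1 by exact: (sup_upper_bound supE).
have t1T : t1 <= T by apply: sup_le_ub => [|t [/andP[]]] //; exists 0.
have t1ab : a < t1 < b by apply/andP; split; lra.
(* A trajectory that ends in [S] also starts in it. Hence [gamma t1] is off [S], and the push around
   it can be supported away from [S]. *)
have nS : (~` S) (gamma t1).
  move=> St; apply: nSx; rewrite -g0; apply: stable_reaches St.
  by apply: curve_reaches ig _ _ _ => //; lra.
have [e [e' [B [[ce ce' eK e'K] [clB BS eid] er em adv]]]] :=
  push_forward hM smA smX (closed_openC stable_closed) nS.
have ep : forward_push e e'.
  split=> //; exists (~` B); split; first exact: closed_openC.
    by move=> z Sz /BS.
  by move=> z /eid.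
have [d d0 [ad [db rd]]] := adv _ _ _ _ ig t1ab erefl.
have [t [/andP[t0 tT] [g [g' [gp gt]]]] td] := sup_adherent d0 supE.
(* [gamma (t1 - d)] reaches [gamma t], which reaches [g x]. The monotone map [e] preserves this and
   carries [gamma (t1 - d)] to or beyond [gamma (t1 + d)], a definite gain over the supremum. *)
have egx : reaches (gamma (t1 + d)) (e (g x)).
  apply: reachesT rd _; apply: em; apply: reachesT gt.
  by apply: curve_reaches ig _ _ _ => //; [lra|exact: ltW].
have QQ u : 0 <= u <= t1 + d -> Q u.
  move=> /andP[u0 ut]; exists (e \o g), (g' \o e'); split; first exact: forward_push_comp.
  by apply: reachesT egx; apply: curve_reaches ig _ _ _ => //; lra.
have [Tt|tT'] := leP T (t1 + d); first by apply: QQ; rewrite T0.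
have : t1 + d <= t1.
  apply: (sup_upper_bound supE); split; first by apply/andP; split; lra.
  by apply: QQ; rewrite lexx andbT; lra.
lra.
Qed.

Lemma push_compact K V : compact K -> K `<=` D -> open V -> S `<=` V ->
  exists g g', forward_push g g' /\ forall x, K x -> captured V (g x).
Proof.
move=> cK KD oV SV.
apply: (compact_induct (P := fun K => exists g g', forward_push g g' /\
   forall x, K x -> captured V (g x))) => //.
- by exists id, id; split=> //; exact: forward_push_id.
(* The composition serves both sets: for [x] in [B], [f] moves the captured [g x] forward; for [x]
   in [C], the captured [f x] reaches [f (g x)] because [f] preserves the order. *)
- move=> B C [g [g' [gp gB]]] [f [f' [fp fC]]].
  exists (f \o g), (g' \o f'); split; first exact: forward_push_comp.
  have [_ _ gr _] := gp; have [_ _ fr fm] := fp.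
  move=> x [/gB|/fC] H; apply: captured_reaches H _; first exact: fr.
  exact: fm.
- by move=> B C BC [g [g' [gp gC]]]; exists g, g'; split=> // x /BC/gC.
- move=> x Kx; have [V2 [oV2 SV2 V2V]] := stable_core oV SV.
  have [g [g' [gp gx]]] := push_point (KD x Kx) oV2 SV2.
  (* Landing in [V2] is an open condition on the point and implies capture by [V]. *)
  exists (g @^-1` V2); last by exists g, g'; split=> // y /= V2y z; exact: V2V.
  have [[cg _ _ _] _ _ _] := gp.
  by apply: (cg x); apply: open_nbhs_nbhs; split=> //; exact: gx.
Qed.

Lemma stable_sub_basin : exists U, [/\ open U, S `<=` U & U `<=` D].
Proof. by case: stS => _ _ [U [oU SU UD]] _; exists U. Qed.

(** A push is continuous and carries [x] into an open part of the basin. Points near [x] land there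
    too, and a point belongs to the basin when its push does; continuity of the long-time flow is
    thus avoided. *)
Lemma basin_open : open D.
Proof.
rewrite openE => x Dx; have [U [oU SU UD]] := stable_sub_basin.
have [g [g' [[[cg _ _ _] _ gr _] gx]]] := push_point Dx oU SU.
have : nbhs x (g @^-1` U).
  by apply: (cg x); apply: open_nbhs_nbhs; split=> //; exact: gx.
by apply: filterS => y Uy; apply/(basin_reaches (gr y)); exact: UD.
Qed.

(** The form in which the dynamics enters the extension of embeddings: trajectories have disappeared
    from the conclusion. *)
Lemma basin_compress K V : compact K -> K `<=` D -> open V -> S `<=` V ->
  exists g g' : M -> M,
  [/\ [/\ continuous g, continuous g', cancel g g' & cancel g' g],
    exists N, [/\ open N, S `<=` N & forall x, N x -> g x = x],
    forall x, K x -> V (g x) &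
    forall x, D x <-> D (g x)].
Proof.
move=> cK KD oV SV; have [g [g' [[gc gN gr _] gV]]] := push_compact cK KD oV SV.
exists g, g'; split=> // x; first by move=> /gV; apply; exact: reaches0.
exact: basin_reaches.
Qed.

End Basin.

(** * A norm on a vector bundle over a compact base *)

Section BundleNorm.
Context {R : realType} {k : nat} {B : topologicalType} {AB : set (chart R k B)} {r : nat}.
Variable E : vector_bundle AB r.
Hypothesis hB : hausdorff_space B.
Hypothesis cB : compact [set: B].

Local Notation T := (total_space E).
Local Notation proj := (@bundle_proj _ _ _ _ _ E).

Lemma fiber_coord (e : T) : exists v : fiber E (proj e), fiber_incl v = e.
Proof.
have [_ _ surj] := fiber_bij E (proj e).
by have [|v _ ve] := surj e; [by []|exists v].
Qed.

(* By [fiber_coord] the default value of [xget] is never taken. *)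
Definition fiber_scale (a : R) (e : T) : T :=
  fiber_incl (a *: xget 0 [set v : fiber E (proj e) | fiber_incl v = e]).

Lemma proj_incl x (v : fiber E x) : proj (fiber_incl v) = x.
Proof. by have [f _ _] := fiber_bij E x; have := f v I. Qed.

Lemma proj_scale a e : proj (fiber_scale a e) = proj e.
Proof. exact: proj_incl. Qed.

(** Keeps from a local trivialization only its fiber coordinate, the inverse map, continuity and
    compatibility with scaling. *)
Lemma trivialization x0 : exists U (Phi : T -> 'rV[R]_r) (Psi : B * 'rV[R]_r -> T),
  [/\ open U /\ U x0,
     forall e, U (proj e) -> {for e, continuous Phi} /\ Psi (proj e, Phi e) = e,
     forall y, U y.1 -> {for y, continuous Psi},
     forall a e, U (proj e) -> Phi (fiber_scale a e) = a *: Phi e &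
     forall x, U x -> Phi (zero_section E x) = 0].
Proof.
have [U [oU Ux0 [Phi [Psi [[_ [cPhi _] [cPsi _] PhiK PsiK] Phi1 lin]]]]] :=
  local_trivialization E x0.
(* Linearity with [a = 1] and both vectors zero says that the image of 0 is twice itself. *)
have P0 x : U x -> (Phi (zero_section E x)).2 = 0.
  move=> Ux; have := lin x Ux 1 0 0; rewrite scale1r addr0 scale1r => /eqP.
  by rewrite -{1}[X in X == _]addr0 (inj_eq (addrI _)) => /eqP <-.
exists U, (fun e => (Phi e).2), Psi; split.
- by [].
- move=> e Ue; split; last by rewrite -(Phi1 e Ue) -surjective_pairing; case: (PhiK e Ue).
  apply: (@continuous_comp _ _ _ Phi snd); first exact: cPhi.
  exact: cvg_snd.
- by move=> y Uy; apply: cPsi.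
- move=> a e Ue; rewrite /fiber_scale.
  have := fiber_coord e; case: xgetP => [v _ ve _|+ [v ve]]; last by move=> /(_ v).
  have := lin _ Ue a v 0; rewrite addr0 => ->.
  by rewrite (P0 _ Ue : (Phi (fiber_incl 0)).2 = 0) addr0 ve.
- exact: P0.
Qed.

(** Points of one fiber are equal when their coordinates in a trivialization are; this reduces the
    scaling laws to identities in R^r. *)
Lemma total_space_ext e e' : proj e = proj e' ->
  (forall U (Phi : T -> 'rV[R]_r) (Psi : B * 'rV[R]_r -> T),
    U (proj e) ->
    (forall a e, U (proj e) -> Phi (fiber_scale a e) = a *: Phi e) ->
    (forall x, U x -> Phi (zero_section E x) = 0) -> Phi e = Phi e') -> e = e'.
Proof.
move=> pe H; have [U [Phi [Psi [[_ Ue] PK _ Ps P0]]]] := trivialization (proj e).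
have [_ <-] := PK e Ue; have [|_ <-] := PK e'; first by rewrite -pe.
by rewrite pe (H U Phi Psi).
Qed.

Lemma fiber_scale1 e : fiber_scale 1 e = e.
Proof.
apply: total_space_ext => [|U Phi _ Ue Ps _]; first exact: proj_scale.
by rewrite proj_scale in Ue; rewrite Ps ?scale1r.
Qed.

Lemma fiber_scaleM a b e : fiber_scale a (fiber_scale b e) = fiber_scale (a * b) e.
Proof.
apply: total_space_ext => [|U Phi _ Ue Ps _]; first by rewrite !proj_scale.
by rewrite !proj_scale in Ue; rewrite !Ps ?scalerA// proj_scale.
Qed.

Lemma proj_zero x : proj (zero_section E x) = x.
Proof. exact: proj_incl. Qed.

Lemma fiber_scale0 e : fiber_scale 0 e = zero_section E (proj e).
Proof.
apply: total_space_ext => [|U Phi _ Ue Ps P0]; first by rewrite proj_scale proj_zero.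
by rewrite proj_scale in Ue; rewrite Ps// P0// scale0r.
Qed.

Lemma proj_continuous : continuous proj.
Proof. by have [c _] := proj_smooth E => x; exact: c. Qed.

(** The factor may vary with the point, as in the radial maps below. Continuity is read off in a
    trivialization, where the map is scalar multiplication of the fiber coordinate. *)
Lemma fiber_scale_continuous (f : T -> R) (e : T) : {for e, continuous f} ->
  {for e, continuous (fun e => fiber_scale (f e) e)}.
Proof.
move=> cf; have [U [Phi [Psi [[oU Ue] PK cPsi Ps _]]]] := trivialization (proj e).
pose F e' := Psi (proj e', f e' *: Phi e').
have FE e' : U (proj e') -> F e' = fiber_scale (f e') e'.
  move=> Ue'; have [|_ <-] := PK (fiber_scale (f e') e'); first by rewrite proj_scale.
  by rewrite Ps// proj_scale.
have cF : {for e, continuous F}.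
  apply: (@continuous_comp _ _ _ (fun e' => (proj e', f e' *: Phi e')) Psi).
    apply: (@cvg_pair _ _ _ _ (nbhs (proj e)) (nbhs (f e *: Phi e))).
      exact: proj_continuous.
    by apply: cvgZ => //; have [] := PK e Ue.
  exact: cPsi.
rewrite /prop_for /continuous_at -FE//; apply: cvg_trans cF.
apply: near_eq_cvg.
have : nbhs e (proj @^-1` U) by apply: proj_continuous; exact: open_nbhs_nbhs.
by apply: filterS => e' Ue'; rewrite FE.
Qed.

(** Continuity and homogeneity hold on the whole bundle, definiteness and properness only over [Q],
    so that a sum of two such functions serves over the union of their sets. *)
Definition partial_norm (Q : set B) (N : T -> R) :=
  [/\ continuous N, forall e, 0 <= N e,
     forall a e, N (fiber_scale a e) = `|a| * N e,
     forall e, Q (proj e) -> N e = 0 -> e = zero_section E (proj e) &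
     forall c, exists2 K, compact K & forall e, Q (proj e) -> N e <= c -> K e].

(** The norm of the fiber coordinate is multiplied by a cut-off function on the base, supported in
    the trivializing set. *)
Lemma partial_norm_exists (x0 : B) : exists2 Q, nbhs x0 Q & exists N, partial_norm Q N.
Proof.
have [U [Phi [Psi [[oU Ux0] PK cPsi Ps P0]]]] := trivialization x0.
have [f [cf f01 fU fx0]] : exists f : B -> R, [/\ continuous f, range f `<=` `[0, 1],
     f @` (~` U) `<=` [set 0] & f @` [set x0] `<=` [set 1]].
  have /(@normal_separatorP R) sepB : normal_space B by exact: compact_normal.
  apply/uniform_separatorP/sepB.
  - exact: open_closedC.
  - by apply: compact_closed => //; exact: compact_set1.
  - by apply/seteqP; split=> // x [nU /= xx0]; apply: nU; rewrite xx0.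
have {}fx0 : f x0 = 1 by apply: fx0; exists x0.
have {}fU x : ~ U x -> f x = 0 by move=> nU; apply: fU; exists x.
(* Subtracting 1/2 from the Urysohn function makes the cut-off vanish on an open set containing the
   complement of [U]; this gives continuity of [N] outside [U]. *)
pose b x := Num.max 0 (f x - 2^-1).
have b0 x : 0 <= b x by rewrite /b le_max lexx.
have cb : continuous b.
  have cm : continuous (fun y : R => Num.max 0 (y - 2^-1)).
    apply: (@lipschitz_continuous _ _ _ _ 1) => // y z; rewrite mul1r ler_norml.
    have := ler_norm (y - z); have := ler_norm (z - y); rewrite distrC.
    by case: (leP 0 (y - 2^-1)) => ?; case: (leP 0 (z - 2^-1)) => ?; lra.
  by move=> x; apply: (@continuous_comp _ _ _ f _ x (cf x) (cm (f x))).
have bf x : f x <= 2^-1 -> b x = 0 by move=> fx; rewrite /b max_l// subr_le0.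
have bq x : 3 / 4 <= f x -> 4^-1 <= b x.
  by move=> fx; rewrite /b le_max; apply/orP; right; lra.
pose N e := b (proj e) * `|if pselect (U (proj e)) then Phi e else 0|.
have NU e : U (proj e) -> N e = b (proj e) * `|Phi e|.
  by move=> Ue; rewrite /N; case: pselect.
have Nb e : b (proj e) = 0 -> N e = 0 by move=> be; rewrite /N be mul0r.
exists [set x | 3 / 4 < f x].
  by apply: (cvgr_gt _ (cf x0)); rewrite fx0; lra.
exists N; split.
- move=> e; have [Ue|nUe] := pselect (U (proj e)).
    rewrite /continuous_at NU//.
    have [cPhi _] := PK e Ue.
    have : b (proj e') * `|Phi e'| @[e' --> e] --> b (proj e) * `|Phi e|.
      apply: cvgM; first by apply: continuous_comp; [exact: proj_continuous|exact: cb].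
      by apply: cvg_norm; exact: cPhi.
    apply: cvg_trans; apply: near_eq_cvg.
    have : nbhs e (proj @^-1` U) by apply: proj_continuous; exact: open_nbhs_nbhs.
    by apply: filterS => e' Ue'; rewrite NU.
  rewrite /continuous_at Nb; last by rewrite bf// fU.
  have : cst (0 : R) @ e --> (0 : R) by exact: cvg_cst.
  apply: cvg_trans; apply: near_eq_cvg.
  have : nbhs e (proj @^-1` [set x | f x < 2^-1]).
    apply: proj_continuous; apply: (cvgr_lt _ (cf (proj e))).
    by rewrite fU.
  by apply: filterS => e' /= /ltW fe; rewrite Nb// bf.
- by move=> e; rewrite /N mulr_ge0.
- move=> a e; have [Ue|nUe] := pselect (U (proj e)).
    by rewrite !NU ?proj_scale// Ps// normrZ mulrCA.
  by rewrite !Nb ?mulr0// bf ?proj_scale// fU.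
- move=> e /= fe Ne.
  have Ue : U (proj e).
    by apply: contrapT => /fU fe0; move: fe; rewrite fe0 ltNge divr_ge0.
  move: Ne; rewrite NU// => /eqP; rewrite mulf_eq0 => /orP[/eqP b0'|].
    by have := bq _ (ltW fe); rewrite b0' leNgt invr_gt0 ltr0n.
  rewrite normr_eq0 => /eqP Pe; have [_ {1}<-] := PK e Ue.
  have [|_ {1}<-] := PK (zero_section E (proj e)); first by rewrite proj_zero.
  by rewrite proj_zero Pe P0.
- move=> c.
  pose Q := [set x | 3 / 4 <= f x].
  have QU x : Q x -> U x.
    by move=> Qx; apply: contrapT => /fU fx; move: Qx; rewrite /Q /= fx leNgt divr_gt0.
  have cQ : compact Q.
    apply: (subclosed_compact _ cB) => //.
    exact: (preimage_closed (fun x _ => cf x) (@closed_ge R _)).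
  (* Over [Q] the cut-off is at least 1/4, so [N e <= c] confines the fiber coordinate to the ball
     of radius [4 * c]. *)
  pose Y := [set v : 'rV[R]_r | `|v| <= 4 * c].
  have cY : compact Y.
    by have := @cball_compact R r 0 (4 * c); under eq_set do rewrite subr0.
  exists (Psi @` (Q `*` Y)).
    apply: continuous_compact; last exact: compact_setX.
    apply: continuous_in_subspaceT => y; rewrite inE => -[Qy _].
    by apply: cPsi; exact: QU.
  move=> e /= fe; have Qe : Q (proj e) by exact: ltW.
  have Ue := QU _ Qe; rewrite NU// => Nc; have [_ ee] := PK e Ue.
  exists (proj e, Phi e) => //; split=> //=.
  have := bq _ Qe.
  move=> /(ler_wpM2r (normr_ge0 (Phi e))); rewrite /Y /= ler_pdivrMl// => /le_trans; apply.
  by rewrite ler_wpM2l.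
Qed.

(** Local solutions add up: the sum dominates each summand, hence is definite and proper over both
    base sets, and the base is compact. *)
Lemma bundle_norm : exists N : T -> R,
  [/\ continuous N, forall e, 0 <= N e,
     forall a e, N (fiber_scale a e) = `|a| * N e,
     forall e, N e = 0 -> e = zero_section E (proj e) &
     forall c, compact [set e | N e <= c]].
Proof.
have [|||| N [cN N0 NM Nz Nc]] :=
  @compact_induct B setT (fun Q => exists N, partial_norm Q N) cB.
- exists (fun=> 0); split=> //; first by move=> e; exact: cvg_cst.
    by move=> a e; rewrite mulr0.
  by exists set0 => //; exact: compact0.
- move=> Q1 Q2 [N1 [cN1 N10 N1M N1z N1c]] [N2 [cN2 N20 N2M N2z N2c]].
  exists (fun e => N1 e + N2 e); split.
  + by move=> e; apply: cvgD; [exact: cN1|exact: cN2].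
  + by move=> e; rewrite addr_ge0.
  + by move=> a e; rewrite N1M N2M mulrDr.
  + move=> e Qe /eqP; rewrite paddr_eq0// => /andP[/eqP e1 /eqP e2].
    by case: Qe => [/N1z|/N2z]; apply.
  + move=> c; have [K1 cK1 K1P] := N1c c; have [K2 cK2 K2P] := N2c c.
    exists (K1 `|` K2); first exact: compactU.
    move=> e Qe ec; case: Qe => [Q1e|Q2e]; [left; apply: K1P|right; apply: K2P] => //.
      by apply: le_trans ec; rewrite lerDl.
    by apply: le_trans ec; rewrite lerDr.
- move=> Q1 Q2 Q12 [N [cN N0 NM Nz Nc]]; exists N; split=> //.
    by move=> e /Q12; exact: Nz.
  by move=> c; have [K cK KP] := Nc c; exists K => // e /Q12; exact: KP.
- by move=> x _; exact: partial_norm_exists.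
exists N; split=> //; first by move=> e; exact: Nz.
move=> c; have [K cK KP] := Nc c; apply: subclosed_compact cK _.
  exact: (preimage_closed (fun x _ => cN x) (@closed_le R _)).
by move=> e /=; exact: KP.
Qed.

End BundleNorm.

(** * Monotone unions of open embeddings *)

Section MobiusFactor.
Context {R : realType} (rho : R).
Hypothesis rho0 : 0 < rho.
Implicit Types c r : R.

(** On [0 <= r <= rho] the radius [r] goes to [mobius_factor c r * r], a Möbius map fixing 0 and
    [rho] with derivative [c] at 0; beyond [rho] the factor is 1. Using the factor instead of the
    radius avoids division by [r] at 0. *)
Definition mobius_factor c r := c * rho / (rho + (c - 1) * Num.min r rho).

Lemma mobius_den c r : 0 < c -> 0 <= r -> 0 < rho + (c - 1) * Num.min r rho.
Proof.
move=> c0 r0; have cr : 0 < c * rho by exact: mulr_gt0.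
case: (leP r rho) => rr; last by lra.
have := mulr_ge0 (ltW c0) r0; have [->|] := eqVneq r rho; first by lra.
move=> ne; have : r < rho by rewrite lt_neqAle ne.
by lra.
Qed.

Lemma mobius_gt0 c r : 0 < c -> 0 <= r -> 0 < mobius_factor c r.
Proof. by move=> c0 r0; rewrite divr_gt0 ?mulr_gt0// mobius_den. Qed.

Lemma mobius_out c r : 0 < c -> rho <= r -> mobius_factor c r = 1.
Proof.
move=> c0 rr; rewrite /mobius_factor min_r//.
have -> : rho + (c - 1) * rho = c * rho by ring.
by rewrite divff// gt_eqF// mulr_gt0.
Qed.

Lemma mobius_in c r : 0 < c -> 0 <= r -> r < rho -> mobius_factor c r * r < rho.
Proof.
move=> c0 r0 rr; have d0 := mobius_den c0 r0.
rewrite /mobius_factor mulrAC ltr_pdivrMr//; rewrite min_l ?ltW// in d0 *.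
have : 0 < rho * (rho - r) by rewrite mulr_gt0// subr_gt0.
lra.
Qed.

(** For [0 < r <= rho] the map multiplies [1/r - 1/rho] by [1/c], so the parameters [c] and [c^-1]
    give inverse maps. Stated for factors, this also covers [r = 0]. *)
Lemma mobius_inv c r : 0 < c -> 0 <= r ->
  mobius_factor c^-1 (mobius_factor c r * r) * mobius_factor c r = 1.
Proof.
move=> c0 r0; have ci0 : 0 < c^-1 by rewrite invr_gt0.
have [rr|rr] := leP rho r; first by rewrite (mobius_out c0 rr) mulr1 mul1r mobius_out.
have k0 : 0 <= mobius_factor c r * r by rewrite mulr_ge0// ltW// mobius_gt0.
have := mobius_den ci0 k0; have := mobius_in c0 r0 rr; have := mobius_den c0 r0.
rewrite {2 4}/mobius_factor /mobius_factor min_l ?ltW// => d0 kr.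
rewrite min_l ?ltW// => d1; field.
rewrite (gt_eqF d0) (gt_eqF c0)/=.
have -> : rho * (rho + (c - 1) * r) + (1 + -1 * c) * (rho * r) = rho * rho by ring.
by rewrite mulf_neq0 ?gt_eqF.
Qed.

Lemma mobius_continuous c r : 0 < c -> 0 <= r -> {for r, continuous (mobius_factor c)}.
Proof.
move=> c0 r0; apply: cvgM; first exact: cvg_cst.
apply: cvgV; first by rewrite gt_eqF// mobius_den.
have cm : continuous (fun x : R => Num.min x rho).
  apply: (@lipschitz_continuous _ _ _ _ 1) => // y z; rewrite mul1r ler_norml.
  have := ler_norm (y - z); have := ler_norm (z - y); rewrite distrC.
  by case: (leP y rho) => ?; case: (leP z rho) => ?; lra.
by apply: cvgD; [exact: cvg_cst|apply: cvgM; [exact: cvg_cst|exact: cm]].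
Qed.

Lemma mobius_small (sigma delta : R) : 0 <= sigma -> sigma < rho -> 0 < delta ->
  exists2 c, 0 < c & forall r, 0 <= r <= sigma -> mobius_factor c r * r <= delta.
Proof.
move=> s0 sr d0.
have q0 : 0 < delta * (rho - sigma) by rewrite mulr_gt0// subr_gt0.
have w0 : 0 <= rho * sigma by rewrite mulr_ge0// ltW.
have w1 : 0 < rho * sigma + 1 by rewrite ltr_wpDl.
(* Up to radius [sigma] the denominator is at least [rho - sigma], and this [c] makes the numerator
   at most [delta] times that. The added 1 avoids division by zero when [sigma = 0]. *)
pose c := delta * (rho - sigma) / (rho * sigma + 1); exists c.
  by rewrite divr_gt0.
move=> r /andP[r0 rs]; have c0 : 0 < c by rewrite divr_gt0.
have den := mobius_den c0 r0; rewrite /mobius_factor mulrAC ler_pdivrMr//.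
rewrite min_l in den *; last by rewrite (le_trans rs)// ltW.
have H1 : c * rho * r <= c * (rho * sigma + 1).
  rewrite -mulrA ler_wpM2l ?(ltW c0)//.
  by have := ler_wpM2l (ltW rho0) rs; lra.
rewrite {2}/c divfK ?gt_eqF// in H1; apply: (le_trans H1).
rewrite ler_wpM2l ?(ltW d0)//.
by have := mulr_ge0 (ltW c0) r0; lra.
Qed.

End MobiusFactor.

(** * Radial homeomorphisms of a space with scaling and a proper norm *)

Section ConeSpace.
Context {R : realType} {T : topologicalType}.
Variables (scale : R -> T -> T) (N : T -> R).
Hypothesis scale1 : forall e, scale 1 e = e.
Hypothesis scaleM : forall a b e, scale a (scale b e) = scale (a * b) e.
Hypothesis scale_continuous : forall (f : T -> R) e, {for e, continuous f} ->
  {for e, continuous (fun e => scale (f e) e)}.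
Hypothesis N0 : forall e, 0 <= N e.
Hypothesis cN : continuous N.
Hypothesis NM : forall a e, N (scale a e) = `|a| * N e.
Hypothesis compactN : forall c, compact [set e | N e <= c].

(** [N] has a positive minimum on the compact part of its unit ball outside [V]; any smaller radius
    works. *)
Lemma zero_nbhs (V : set T) : open V -> [set e | N e = 0] `<=` V ->
  exists2 d, 0 < d & forall e, N e <= d -> V e.
Proof.
move=> oV V0; pose K := [set e | N e <= 1] `&` ~` V.
have cK : compact K by apply: compact_closedI => //; exact: open_closedC.
have [K0|K0] := pselect (K !=set0); last first.
  by exists 1 => // e e1; apply: contrapT => nV; apply: K0; exists e.
have [e1 + mn] := compact_EVT_min K0 cK (continuous_subspaceT cN).
rewrite inE => -[_ nV1].
have e10 : 0 < N e1 by rewrite lt_neqAle N0 andbT eq_sym; apply/eqP => /V0.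
exists (Num.min 1 (N e1 / 2)); first by rewrite lt_min ltr01 divr_gt0.
move=> e; rewrite le_min => /andP[le1 le2]; apply: contrapT => nVe.
have := mn e; rewrite inE => /(_ (conj le1 nVe)); lra.
Qed.

(** Each point is scaled by the Möbius factor of its norm, with parameter [c] for [s] and [c^-1] for
    its inverse. *)
Lemma radial_homeo (sigma rho delta : R) : 0 <= sigma -> sigma < rho -> 0 < delta ->
  exists s s' : T -> T,
  [/\ [/\ continuous s, continuous s', cancel s s' & cancel s' s],
     forall e, rho < N e -> s e = e /\ s' e = e,
     forall e, N e < rho -> N (s' e) < rho,
     forall e, N e <= rho -> N (s e) <= rho &
     forall e, N e <= sigma -> N (s e) <= delta].
Proof.
move=> s0 sr d0; have rho0 : 0 < rho by exact: le_lt_trans sr.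
have [c c0 cP] := mobius_small rho0 s0 sr d0.
have ci0 : 0 < c^-1 by rewrite invr_gt0.
pose f c e := scale (mobius_factor rho c (N e)) e.
have Nf b e : 0 < b -> N (f b e) = mobius_factor rho b (N e) * N e.
  by move=> b0; rewrite NM gtr0_norm// mobius_gt0.
have cf b : 0 < b -> continuous (f b).
  move=> b0 e; apply: scale_continuous.
  by apply: (@continuous_comp _ _ _ N); [exact: cN|exact: mobius_continuous].
have fK b : 0 < b -> cancel (f b) (f b^-1).
  by move=> b0 e; rewrite {1}/f Nf// scaleM mobius_inv ?scale1.
have fout b e : 0 < b -> rho <= N e -> f b e = e.
  by move=> b0 re; rewrite /f mobius_out.
have fin b e : 0 < b -> N e < rho -> N (f b e) < rho.
  by move=> b0 re; rewrite Nf// mobius_in.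
exists (f c), (f c^-1); split.
- by split; [exact: cf|exact: cf|exact: fK|rewrite -{2}[c]invrK; exact: fK].
- by move=> e /ltW re; rewrite !fout.
- by move=> e; exact: fin.
- move=> e; rewrite le_eqVlt => /orP[/eqP re|re]; last by rewrite ltW// fin.
  by rewrite fout// re.
- by move=> e es; rewrite Nf// cP// N0.
Qed.

End ConeSpace.

Section OpenEmbedding.
Context {T M : topologicalType}.

Definition open_embedding (h : T -> M) :=
  [/\ injective h, continuous h & forall U, open U -> open (h @` U)].

Lemma homeo_open (f g : M -> M) (U : set M) : continuous g -> cancel f g -> cancel g f ->
  open U -> open (f @` U).
Proof.
move=> cg fK gK oU; have -> : f @` U = g @^-1` U.
  apply/seteqP; split=> [_ [x Ux <-]|x Ux]; first by rewrite /preimage /= fK.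
  by exists (g x).
exact: (continuousP _).1.
Qed.

Lemma open_embedding_comp (h : T -> M) (f g : M -> M) (s s' : T -> T) :
  open_embedding h -> continuous f -> continuous g -> cancel f g -> cancel g f ->
  continuous s -> (forall U, open U -> open (s @` U)) -> injective s ->
  open_embedding (f \o h \o s).
Proof.
move=> [ih ch oh] cf cg fK gK cs os injs; split.
- by apply: inj_comp => //; apply: inj_comp => //; exact: can_inj fK.
- move=> x; apply: (@continuous_comp _ _ _ s); first exact: cs.
  by apply: (@continuous_comp _ _ _ h); [exact: ch|exact: cf].
- move=> U oU; have -> : (f \o h \o s) @` U = f @` (h @` (s @` U)).
    by rewrite !image_comp.
  by apply: homeo_open cg fK gK _; apply: oh; exact: os.
Qed.

End OpenEmbedding.

(** * Extending embeddings step by step and passing to the limit *)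

Section MonotoneUnion.
Context {R : realType} {T M : topologicalType}.
Variables (scale : R -> T -> T) (N : T -> R) (S D : set M).
Hypothesis hM : hausdorff_space M.
Hypothesis scale1 : forall e, scale 1 e = e.
Hypothesis scaleM : forall a b e, scale a (scale b e) = scale (a * b) e.
Hypothesis scale_continuous : forall (f : T -> R) e, {for e, continuous f} ->
  {for e, continuous (fun e => scale (f e) e)}.
Hypothesis N0 : forall e, 0 <= N e.
Hypothesis cN : continuous N.
Hypothesis NM : forall a e, N (scale a e) = `|a| * N e.
Hypothesis compactN : forall c, compact [set e | N e <= c].
Hypothesis compress : forall K V, compact K -> K `<=` D -> open V -> S `<=` V ->
  exists g g' : M -> M,
  [/\ [/\ continuous g, continuous g', cancel g g' & cancel g' g],
    exists W, [/\ open W, S `<=` W & forall x, W x -> g x = x],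
    forall x, K x -> V (g x) &
    forall x, D x <-> D (g x)].

(** Since the zero set goes onto [S], the image of every open ball is an open set around [S], as
    compression requires. *)
Definition core_embedding (h : T -> M) :=
  [/\ open_embedding h, h @` [set e | N e = 0] = S & forall e, D (h e)].

Let open_ball c : open [set e | N e < c].
Proof.
have -> : [set e | N e < c] = N @^-1` [set x | x < c] by [].
by apply: open_comp => [x _|]; [exact: cN|exact: open_lt].
Qed.

Lemma core_embedding_extend (h : T -> M) (n : nat) (K : set M) :
  core_embedding h -> compact K -> K `<=` D -> exists h' : T -> M,
  [/\ core_embedding h', forall e, N e <= n%:R -> h' e = h e &
     forall y, K y -> exists2 e, N e < n.+1%:R & h' e = y].
Proof.
move=> [oeh hS hD] cK KD; have [ih ch oh] := oeh.
have nn : n%:R < n.+1%:R :> R by rewrite ltr_nat.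
have n0 : 0 <= n%:R :> R by rewrite ler0n.
pose B := [set e | N e <= n.+1%:R]; pose V := h @` [set e | N e < n.+1%:R].
have cB : compact B by exact: compactN.
have chB : compact (h @` B) by apply: continuous_compact => //; exact: continuous_subspaceT.
have SV : S `<=` V.
  by rewrite -hS => _ [e /= e0 <-]; exists e => //=; rewrite e0 ltr0n.
(* The image of [B] is compressed along with [K], because the map [t] below moves points of that
   image around inside it. *)
have K'D : K `|` h @` B `<=` D by move=> y [/KD//|[e _ <-]].
have [g [g' [[cg cg' gK g'K] [W [oW SW gW]] gV gD]]] :=
  compress (compactU cK chB) K'D (oh _ (open_ball _)) SV.
have [d d0 dW] : exists2 d, 0 < d & forall e, N e <= d -> W (h e).
  apply: (zero_nbhs N0 cN compactN).
    exact: (open_comp (fun x _ => ch x) oW).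
  by move=> e e0; apply: SW; rewrite -hS; exists e.
have [s [s' [[cs cs' sK s'K] sout s'lt sle ssmall]]] :=
  radial_homeo scale1 scaleM scale_continuous N0 cN NM n0 nn d0.
have sB e : ~ B e -> s e = e /\ s' e = e by move=> /negP; rewrite -ltNge => /sout.
(* [t] is [s] transported by [h] and extended by the identity, so that [t] after [h] is [h] after
   [s]. *)
have [t [t' [[ct ct'] [tK t'K] th t'h tout]]] := @extend_homeo T M setT B h hM
  (fun x y _ _ => @ih x y) (fun x _ => ch x) (fun U oU _ => oh U oU) openT
  cB (fun _ _ => I) s s' (fun _ _ => I) (fun x _ => cs x)
  (fun x _ nB => (sB x nB).1) (fun _ _ => I) (fun x _ => cs' x)
  (fun x _ nB => (sB x nB).2) (fun x _ => sK x) (fun x _ => s'K x).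
have tD y : D y -> D (t' y).
  have [[e Be <-]|nB] := pselect ((h @` B) y); first by rewrite t'h.
  by have [_ ->] := tout y nB.
have g'D y : D y -> D (g' y) by move=> Dy; apply/gD; rewrite g'K.
pose h' := t' \o g' \o h \o s.
(* On the ball of radius [n], [s] squeezes points to where [g], hence [g'], is the identity on their
   images; then [t'] undoes [s]. *)
have h'n e : N e <= n%:R -> h' e = h e.
  move=> en; have Ws := dW _ (ssmall e en).
  by rewrite /h' /= -{1}(gW _ Ws) gK t'h// sK.
exists h'; split=> //.
- split.
  + apply: (@open_embedding_comp _ _ h (t' \o g') (g \o t) s s') => //.
    * by move=> x; apply: continuous_comp; [exact: cg'|exact: ct'].
    * by move=> x; apply: continuous_comp; [exact: ct|exact: cg].
    * by move=> x /=; rewrite t'K g'K.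
    * by move=> x /=; rewrite gK tK.
    * by move=> U; exact: homeo_open cs' sK s'K.
    * exact: can_inj sK.
  + rewrite -hS; apply/seteqP; split=> _ [e /= e0 <-]; exists e => //;
    by rewrite h'n// e0.
  + by move=> e; apply: tD; apply: g'D.
(* [t] keeps [y] in the compressed set, so [g (t y)] is [h e] with [e] in the open ball; then [h']
   maps [s' e] to [y]. *)
- move=> y Ky; have K't : (K `|` h @` B) (t y).
    have [[e Be <-]|nB] := pselect ((h @` B) y).
      by right; rewrite th//; exists (s e) => //; exact: sle.
    by left; have [-> _] := tout y nB.
  have [e /= e1 he] := gV _ K't.
  by exists (s' e); [exact: s'lt|rewrite /h' /= s'K he gK tK].
Qed.

Lemma core_embedding_shrink (h : T -> M) (U : set M) : open_embedding h ->
  h @` [set e | N e = 0] = S -> open U -> S `<=` U -> U `<=` D ->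
  exists h', core_embedding h'.
Proof.
move=> oeh hS oU SU UD; have [ih ch oh] := oeh.
have [d d0 dU] : exists2 d, 0 < d & forall e, N e <= d -> U (h e).
  apply: (zero_nbhs N0 cN compactN).
    exact: (open_comp (fun x _ => ch x) oU).
  by move=> e e0; apply: SU; rewrite -hS; exists e.
have N1 e : 0 < 1 + N e by rewrite ltr_pwDl.
(* [q] maps the whole space radially onto the open ball of radius [d]: a norm [m] becomes
   [d * m / (1 + m)]. Its inverse [q'] is meaningful only where [N e < d]. *)
pose q e := scale (d / (1 + N e)) e; pose q' e := scale (d - N e)^-1 e.
have Nq e : N (q e) = d / (1 + N e) * N e by rewrite NM gtr0_norm// divr_gt0.
have dNq e : d - N (q e) = d / (1 + N e).
  by rewrite Nq; field; rewrite gt_eqF.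
have Nqd e : N (q e) < d by rewrite -subr_gt0 dNq divr_gt0.
have qK e : q' (q e) = e.
  rewrite /q' dNq scaleM mulVf ?scale1// mulf_neq0 ?gt_eqF//.
  by rewrite invr_gt0.
have q'K e : N e < d -> q (q' e) = e.
  move=> ed; have de : 0 < d - N e by rewrite subr_gt0.
  rewrite /q /q' scaleM NM gtr0_norm ?invr_gt0//.
  have -> : d / (1 + (d - N e)^-1 * N e) * (d - N e)^-1 = 1; last exact: scale1.
  field; rewrite gt_eqF//= subrK gt_eqF//.
have cq : continuous q.
  move=> e; apply: scale_continuous; apply: cvgM; first exact: cvg_cst.
  apply: cvgV; first by rewrite gt_eqF.
  by apply: cvgD; [exact: cvg_cst|exact: cN].
have cq' e : N e < d -> {for e, continuous q'}.
  move=> ed; apply: scale_continuous; apply: cvgV.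
    by rewrite gt_eqF// subr_gt0.
  by apply: cvgB; [exact: cvg_cst|exact: cN].
exists (h \o q); split.
- split.
  + by apply: inj_comp => //; exact: can_inj qK.
  + by move=> x; apply: continuous_comp; [exact: cq|exact: ch].
  + move=> O oO; rewrite -image_comp; apply: oh; rewrite openE => _ [e Oe <-].
    have : nbhs (q e) [set e' | N e' < d /\ O (q' e')].
      apply: filterI; first by apply: open_nbhs_nbhs; split; [exact: open_ball|exact: Nqd].
      by apply: (cq' _ (Nqd e)); rewrite qK; exact: open_nbhs_nbhs.
    by apply: filterS => e' [ed Oq]; exists (q' e') => //; exact: q'K.
- rewrite -hS; apply/seteqP; split=> [_ [e /= e0 <-]|_ [e /= e0 <-]].
    by exists (q e) => //=; rewrite Nq e0 mulr0.
  exists (q' e) => /=; last by rewrite q'K// e0.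
  by rewrite NM e0 mulr0.
- by move=> e; apply: UD; apply: dU; exact: ltW.
Qed.

(** The successive embeddings stabilize on every ball, so their limit is locally one of them and
    inherits continuity and openness. Injectivity is checked at a stage whose ball contains both
    points. *)
Lemma core_embedding_exhaust (h : T -> M) (K : nat -> set M) : core_embedding h ->
  (forall n, compact (K n)) -> D = \bigcup_n K n ->
  exists f : T -> M, open_embedding f /\ range f = D.
Proof.
move=> hh cK DK.
have KD n : K n `<=` D by rewrite DK => y Ky; exists n.
have /choice[F FP] : forall p : nat * {h | core_embedding h},
  exists h' : {h | core_embedding h},
    (forall e, N e <= p.1%:R -> sval h' e = sval p.2 e) /\
    (forall y, K p.1 y -> exists2 e, N e < p.1.+1%:R & sval h' e = y).
  move=> [n [k kP]] /=.
  have [h' [h'P h'n h'K]] := core_embedding_extend n kP (cK n) (@KD n).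
  by exists (exist _ h' h'P).
pose G := fix G n := if n is m.+1 then F (m, G m) else exist _ h hh.
pose H n := sval (G n).
have HP n : core_embedding (H n) by exact: svalP.
have HS n e : N e <= n%:R -> H n.+1 e = H n e by exact: (FP (n, G n)).1.
have HK n y : K n y -> exists2 e, N e < n.+1%:R & H n.+1 e = y by exact: (FP (n, G n)).2.
have Hm n m e : N e <= n%:R -> H (m + n)%N e = H n e.
  move=> en; elim: m => // m <-; rewrite addSn HS//.
  by rewrite (le_trans en)// ler_nat leq_addl.
(* The strict bound [N e < (i e)%:R] makes the limit coincide with [H (i e)] on a neighborhood of
   [e], not only at [e]. *)
pose i e := (Num.trunc (N e)).+1.
have iP e : N e < (i e)%:R by rewrite truncnS_gt.
pose f e := H (i e) e.
have fH n e : N e <= n%:R -> f e = H n e.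
  move=> en; have [le|/ltnW le] := leqP n (i e).
    by rewrite /f -(subnK le) Hm.
  by rewrite /f -(subnK le) Hm// ltW.
exists f; split; first split.
- move=> x y; have xn : N x <= (maxn (i x) (i y))%:R.
    by rewrite (le_trans (ltW (iP x)))// ler_nat leq_maxl.
  have yn : N y <= (maxn (i x) (i y))%:R.
    by rewrite (le_trans (ltW (iP y)))// ler_nat leq_maxr.
  rewrite (fH _ _ xn) (fH _ _ yn).
  by have [[ih _ _] _ _] := HP (maxn (i x) (i y)); exact: ih.
- move=> e; have [[_ ch _] _ _] := HP (i e).
  apply: cvg_trans (ch e); apply: near_eq_cvg.
  have : nbhs e [set e' | N e' < (i e)%:R].
    by apply: open_nbhs_nbhs; split; [exact: open_ball|exact: iP].
  by apply: filterS => e' /ltW /fH ->.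
- move=> O oO; rewrite openE => _ [e Oe <-].
  have [[_ _ oh] _ _] := HP (i e).
  apply: (@filterS _ _ _ (H (i e) @` (O `&` [set e' | N e' < (i e)%:R]))).
    by move=> _ [e' [Oe' /ltW ee'] <-]; exists e' => //; exact: fH.
  apply: open_nbhs_nbhs; split; last by exists e => //; split => //; exact: iP.
  by apply: oh; apply: openI => //; exact: open_ball.
- apply/seteqP; split=> [_ [e _ <-]|y].
    by have [_ _] := HP (i e); exact.
  rewrite {1}DK => -[n _ /HK[e en he]]; exists e => //.
  by rewrite (fH n.+1)// ltW.
Qed.

End MonotoneUnion.

(** * Compact exhaustion and comparison of the images *)

Lemma sigma_compact (T : topologicalType) (D : set T) : @second_countable T ->
  (forall x, D x -> exists K, [/\ compact K, nbhs x K & K `<=` D]) ->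
  exists K : nat -> set T, (forall n, compact (K n)) /\ D = \bigcup_n K n.
Proof.
move=> [B /countable_injP[f finj] [_ Bbasis]] locD.
(* The compact sets are indexed by the numbering of a countable base: [K n] contains the basic set
   numbered [n] if some compact subset of [D] does, and is empty otherwise. *)
have /choice[K KP] : forall n, exists K : set T, [/\ compact K, K `<=` D &
    forall U K', B U -> f U = n -> compact K' -> U `<=` K' -> K' `<=` D -> U `<=` K].
  move=> n; have [[U [K' [BU fU cK' UK' K'D]]]|no] := pselect (exists U K',
      [/\ B U, f U = n, compact K', U `<=` K' & K' `<=` D]).
    exists K'; split=> // U' K'' BU' fU' _ _ _.
    by rewrite (finj U' U) ?inE// fU' fU.
  exists set0; split=> //; first exact: compact0.
  by move=> U K' BU fU cK' UK' K'D; case: no; exists U, K'.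
exists K; split; first by move=> n; have [] := KP n.
apply/seteqP; split=> [x Dx|x [n _]]; last by have [_ + _] := KP n; exact.
have [K' [cK' xK' K'D]] := locD x Dx.
have [U [BU Ux] UK'] := Bbasis x K' xK'.
by exists (f U) => //; have [_ _ H] := KP (f U); exact: (H U K').
Qed.

Lemma manifold_locally_compact (R : realType) (n : nat) (M : topologicalType)
    (A : set (chart R n M)) (V : set M) (x : M) : smooth_atlas A -> open V -> V x ->
  exists K, [/\ compact K, nbhs x K & K `<=` V].
Proof.
move=> smA oV Vx; have [chA /(_ x)[c Ac cx] _] := smA.
have [od oi K cf cb] := chA c Ac.
have : nbhs (fwd c x) [set y | img c y /\ V (bwd c y)].
  apply: filterI; first by apply: open_nbhs_nbhs; split=> //; exact: img_fwd.
  by apply: (cb _ (img_fwd cx)); rewrite K//; exact: open_nbhs_nbhs.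
move=> /nbhs_ballP[r /= r0 rP].
have r2 : 0 < r / 2 by rewrite divr_gt0.
have sub y : `|y - fwd c x| <= r / 2 -> img c y /\ V (bwd c y).
  move=> yr; apply: rP; rewrite -ball_normE /= distrC (le_lt_trans yr)//.
  by rewrite ltr_pdivrMr// ltr_pMr// ltr1n.
exists (bwd c @` [set y | `|y - fwd c x| <= r / 2]); split.
- apply: continuous_compact; last exact: cball_compact.
  apply: continuous_in_subspaceT => y; rewrite inE => /sub[iy _]; exact: cb.
- have : nbhs x [set z | dom c z /\ `|fwd c z - fwd c x| <= r / 2].
    apply: filterI; first exact: open_nbhs_nbhs.
    by have /cvgrPdistC_le/(_ _ r2) := cf _ cx.
  by apply: filterS => z [cz zr]; exists (fwd c z) => //; exact: K.
- by move=> _ [y /sub[]] _ + <-.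
Qed.

Lemma compact_set_type (T : topologicalType) (S : set T) : compact S ->
  compact [set: set_type S].
Proof.
move=> cS F FF _.
have [|s [Ss cl]] := cS (set_val @ F) _.
  change (F (set_val @^-1` S)).
  by apply: (@filterS _ F _ setT); [move=> x _; exact: set_valP|exact: filterT].
exists (SigSub (mem_set Ss)); split=> // P Q FP.
rewrite nbhsE => -[_ [[V oV <-] Vs] VQ].
have FP' : (set_val @ F) (set_val @` P).
  change (F (set_val @^-1` (set_val @` P))).
  by apply: (@filterS _ F _ P) => // x Px; exists x.
have [_ [[x Px <-] Vx]] := cl _ _ FP' (open_nbhs_nbhs (conj oV Vs)).
by exists x; split=> //; exact: VQ.
Qed.

(** Both ranges are copies of [T]: the point [k e] is sent to [l e], which is continuous because [k]
    is open and [l] is continuous. *)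
Lemma open_embedding_homeomorphic (T M : topologicalType) (f h : T -> M) :
  open_embedding f -> open_embedding h ->
  homeomorphic (set_type (range f)) (set_type (range h)).
Proof.
move=> oef oeh.
have inv (k : T -> M) : forall x : set_type (range k), exists e, k e = set_val x.
  by move=> x; have [e _ ke] := set_valP x; exists e.
have transfer (k l : T -> M) : open_embedding k -> open_embedding l ->
    exists G : set_type (range k) -> set_type (range l), continuous G /\
      forall x e, k e = set_val x -> set_val (G x) = l e.
  move=> [ik ck ok] [il cl ol]; have /choice[e eP] := inv k.
  exists (fun x => SigSub (mem_set (imageT l (e x)))); split; last first.
    by move=> x e'; rewrite -eP => /ik ->.
  apply/continuousP => _ [V oV <-].
  exists (k @` (l @^-1` V)); first by apply: ok; exact: (continuousP _).1.
  apply/seteqP; split=> x.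
    by move=> [e' Ve']; rewrite -eP => /ik E; rewrite /= -E.
  by move=> Vx; exists (e x).
have [G [cG GE]] := transfer f h oef oeh.
have [H [cH HE]] := transfer h f oeh oef.
exists G, H; split=> // x; apply: val_inj.
  by have [e fe] := inv f x; exact: (etrans (HE _ _ (esym (GE _ _ fe))) fe).
by have [e he] := inv h x; exact: (etrans (GE _ _ (esym (HE _ _ he))) he).
Qed.

Theorem theorem1 (R : realType)
    (n : nat) (M : topologicalType) (AM : set (chart R n M))
    (M_manifold : smooth_manifold AM)
    (X : chart R n M -> M -> 'rV[R]_n)
    (X_smooth : smooth_vector_field AM X)
    (S : set M) (k : nat) (AS : set (chart R k (set_type S)))
    (S_submanifold : embedded_submanifold AM AS)
    (S_compact : compact S)
    (S_stable : asymptotically_stable AM X S)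
    (r : nat) (E : vector_bundle AS r) (tau : total_space E -> M)
    (tau_tubular : tubular_neighborhood AM tau) :
  homeomorphic (set_type (domain_of_attraction AM X S))
               (set_type (range tau)).
Proof.
have [hM scM _ smA] := M_manifold.
have [[hS _ _ _] _] := S_submanifold.
have cS := compact_set_type S_compact.
have [[_ _ [itau ctau _]] otau tau0] := tau_tubular.
have oe_tau : open_embedding tau by split.
have [N [cN N0 NM Nz compactN]] := bundle_norm E hS cS.
(* The zero set of the norm is the zero section, which [tau] maps onto [S]. *)
have tauS : tau @` [set e | N e = 0] = S.
  apply/seteqP; split=> [_ [e /= /Nz -> <-]|x Sx]; first by rewrite tau0; exact: set_valP.
  exists (zero_section E (SigSub (mem_set Sx))); last by rewrite tau0.
  by rewrite /= -[X in zero_section E X](proj_zero E) -fiber_scale0 NM normr0 mul0r.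
have [U [oU SU UD]] := stable_sub_basin S_stable.
have compress := basin_compress hM smA X_smooth S_stable.
have oD := basin_open hM smA X_smooth S_stable.
have [h0 h0P] := core_embedding_shrink
  (@fiber_scale1 _ _ _ _ _ E) (@fiber_scaleM _ _ _ _ _ E)
  (@fiber_scale_continuous _ _ _ _ _ E) N0 cN NM compactN oe_tau tauS oU SU UD.
(* The basin is open in a second countable, locally compact space, hence a countable union of
   compact sets, which the successive embeddings absorb one by one. *)
have [K [cK DK]] := sigma_compact scM (fun x Dx => manifold_locally_compact smA oD Dx).
have [f [oef <-]] := core_embedding_exhaust hM
  (@fiber_scale1 _ _ _ _ _ E) (@fiber_scaleM _ _ _ _ _ E)
  (@fiber_scale_continuous _ _ _ _ _ E) N0 cN NM compactN compress h0P cK DK.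
exact: open_embedding_homeomorphic.
Qed.
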